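(* Let $V(x)=x^2$, so that $\lambda_m^0=(2m+1)h$ for each integer $m\ge0$, and let $\Omega(R)=(-R,R)$ for $R>0$. Fix an integer $m\ge0$. Then for $R^{-2}h$ sufficiently small depending on $m$, $$\lambda_m^{\Omega(R)}=(2m+1)h+\frac{h^{\frac12-m}\,2^{2+m}}{m!\,\pi^{1/2}}\,R^{2m+1}e^{-R^2/h}\left(1+\mathcal{O}(R^{-2}h)\right).$$
   Context: $D_x=-i\,d/dx$, $h>0$. $\lambda_m^0$ is the $m$'th eigenvalue of $h^2D_x^2+x^2$ on $L^2(\mathbb{R})$, and $\lambda_m^{\Omega(R)}$ is the $m$'th eigenvalue of the self-adjoint operator $h^2D_x^2+x^2$ on $L^2((-R,R))$ with Dirichlet boundary conditions at $\pm R$; eigenvalues are numbered from $m=0$ in increasing order. The implied constant in $\mathcal{O}(R^{-2}h)$ does not depend on $R$ or $h$. *)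

(* Defs.v *)
From HB Require Import structures.
From mathcomp Require Import all_boot all_order all_algebra.
From mathcomp Require Import all_classical all_reals all_analysis.
From mathcomp Require Import complex.

Set Implicit Arguments.
Unset Strict Implicit.
Unset Printing Implicit Defensive.
Import Order.TTheory GRing.Theory Num.Theory.
Import numFieldNormedType.Exports.

Local Open Scope classical_set_scope.
Local Open Scope ring_scope.

(* Complex functions on an open set [Om] are represented by total functions
   [R -> R[i]], of which only the values on [Om] matter; they are measured and
   integrated componentwise. *)
Section defs.
Variable R : realType.
Local Notation C := R[i].
Local Notation mu := (@lebesgue_measure R).

Definition Cintegrable (D : set R) (f : R -> C) : Prop :=
  mu.-integrable D (fun x => (complex.Re (f x))%:E) /\
  mu.-integrable D (fun x => (complex.Im (f x))%:E).

Definition Cintegral (D : set R) (f : R -> C) : C :=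
  Complex (\int[mu]_(x in D) complex.Re (f x))
          (\int[mu]_(x in D) complex.Im (f x)).

Definition L2 (Om : set R) (f : R -> C) : Prop :=
  (fun x => complex.Re (f x)) \_ Om \in Lfun mu 2%:E /\
  (fun x => complex.Im (f x)) \_ Om \in Lfun mu 2%:E.

Definition aeeq (Om : set R) (f g : R -> C) : Prop :=
  {ae mu, forall x, Om x -> f x = g x}.

(* [v] is the weak derivative D_x u = -i u' on [Om], [u] being the locally
   absolutely continuous representative of its class: u' = i v. *)
Definition Dx (Om : set R) (u v : R -> C) : Prop :=
  forall x y : R, x <= y -> `[x, y] `<=` Om ->
    Cintegrable `[x, y] v /\ u y - u x = ('i)%C * Cintegral `[x, y] v.

(* Empty when [Om] is the whole line. *)
Definition dirichlet (Om : set R) (u : R -> C) : Prop :=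
  forall b : R, closure Om b -> ~ Om b ->
    complex.Re (u x) @[x --> within Om (nbhs b)] --> (0 : R) /\
    complex.Im (u x) @[x --> within Om (nbhs b)] --> (0 : R).

(* Graph of the operator h^2 D_x^2 + V on L^2(Om) with Dirichlet boundary
   conditions, taken on its maximal domain. For V = x^2 it is the usual
   self-adjoint realization: on a bounded interval the domain is H^2 with
   vanishing boundary values, i.e. H^2 and H^1_0; on the line the operator is
   limit point at both ends, so no boundary condition occurs. *)
Definition schrodinger (Om : set R) (V : R -> R) (h : R) (u f : R -> C) : Prop :=
  [/\ L2 Om u, L2 Om f, dirichlet Om u &
      exists v w : R -> C, [/\ Dx Om u v, Dx Om v w &
        aeeq Om f (fun x => (h ^+ 2)%:C%C * w x + (V x)%:C%C * u x)]].

Definition eigenvector (Om : set R) (V : R -> R) (h l : R) (u : R -> C) : Prop :=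
  schrodinger Om V h u (fun x => l%:C%C * u x).

Definition lin_indep (Om : set R) (n : nat) (e : 'I_n -> R -> C) : Prop :=
  forall c : 'I_n -> C,
    aeeq Om (fun x => \sum_(i < n) c i * e i x) (fun=> 0) -> forall i, c i = 0.

(* [lam] is the [m]-th eigenvalue (from 0) when the eigenvalues are listed in
   increasing order with multiplicity: [l 0 <= ... <= l m = lam] is a list of
   eigenvalues with linearly independent eigenvectors [e i], and no eigenvalue
   below [lam], nor any part of its multiplicity, is missing from the entries
   before [m]. *)
Definition nth_eigenvalue (Om : set R) (V : R -> R) (h : R) (m : nat) (lam : R)
    : Prop :=
  exists (l : 'I_m.+1 -> R) (e : 'I_m.+1 -> R -> C),
    [/\ {homo l : i j / (i <= j)%N >-> i <= j},
        forall i, eigenvector Om V h (l i) (e i),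
        lin_indep Om e,
        l ord_max = lam &
        forall (k : R) (u : R -> C), k < lam -> eigenvector Om V h k u ->
          exists c : 'I_m.+1 -> C,
            aeeq Om u (fun x => \sum_(i < m.+1 | (i < m)%N) c i * e i x)].

End defs.

(* Main.v *)
Require Import Defs.
From HB Require Import structures.
From mathcomp Require Import all_boot all_order all_algebra.
From mathcomp Require Import all_classical all_reals all_analysis.
From mathcomp Require Import measurable_realfun complex.
From mathcomp Require Import ring lra zify.

Set Implicit Arguments.
Unset Strict Implicit.
Unset Printing Implicit Defensive.
Import Order.TTheory GRing.Theory Num.Theory.
Import numFieldNormedType.Exports.

Local Open Scope classical_set_scope.
Local Open Scope ring_scope.

(** In the variable [x / sqrt h] the operator is [h] times [- d^2/dx^2 + x^2] on the
    interval of half-width [L = a / sqrt h], so only the dependence on [L] matters.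
    For a spectral parameter [mu] the even ([p = 0]) and the odd ([p = 1]) solution
    are [exp (- x^2 / 2) * x^p * kummer p alpha (x^2)] with
    [alpha = (2 p + 1 - mu) / 4], where [kummer] is a confluent hypergeometric
    series with explicit coefficients. A weak eigenvector is a classical solution
    (weak_ode), hence a combination of these two (osc_span), and the whole problem
    becomes one about the values of [alpha] for which such a solution is square
    integrable on the line, or vanishes at [x = L].

    On the line, the series grows like [exp (x^2)] up to powers of [x] unless it
    terminates (kummer_growth), which beats the Gaussian factor. It terminates for
    [alpha = - n], that is [mu = 2 (2 n + p) + 1], and then gives the Hermite
    functions.

    On the interval, the series is positive for [alpha >= 0], so let
    [alpha = - n - d] with [0 <= d < 1] and put [m = 2 n + p]. The terms of degree
    greater than [n] have a common sign and the common factor [d]; the others form a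
    polynomial whose sign is opposite to theirs for large [z]. Up to a nonzero factor
    the equation reads, with [z = L^2],
      [d * (4 z)^(n + 1) * kummer (m + 2) (1 - d) z = (4 z)^n / m! * (1 + O(1/z))]
    (kummer_balance). Since the left-hand series is exponentially large, there is
    exactly one solution [d], and it is exponentially small (balance0_small,
    balance0_exists, balance0_uniq). Its size follows from the series at [d = 0]:
    [x * kummer 1 1 (x^2)] is [exp (x^2)] times the integral of [exp (- t^2)] from
    [0] to [x], which is the source of [sqrt pi], and raising the index divides by
    [2 z] up to a factor [1 + O(1/z)] (kummer_step). This gives
    [d = 2^m L^(2 m + 1) exp (- L^2) / (m! sqrt pi) * (1 + O(L^-2))]
    (balance0_asymp), and the eigenvalue is [h (2 m + 1 + 4 d)].

    For the numbering, each [j] up to [m] has its own [d] with [0 < d <= 1/4], so that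
    the eigenvalues found increase strictly with [j]; there are no others below,
    because an eigenvector is a sum of an even and an odd one, each of which is
    determined up to a factor. Eigenvectors for distinct eigenvalues are independent
    (osc_independent). *)

(** * Calculus on segments *)

Section calculus.
Variable R : realType.
Implicit Types (f F : R -> R) (a b x : R).
Local Notation mu := (@lebesgue_measure R).

Lemma is_derive_cts f df x : is_derive x (1 : R) f df -> {for x, continuous f}.
Proof. by move=> [/derivable1_diffP/differentiable_continuous]. Qed.

Lemma is_derive_within_cts F f a b :
  (forall x, a <= x <= b -> is_derive x (1 : R) F (f x)) ->
  {within `[a, b], continuous F}.
Proof.
move=> dF; apply: derivable_within_continuous => x; rewrite in_itv /= => xab.
by case: (dF x xab).
Qed.

Lemma MVT_is_derive F f a b : a < b ->
  (forall x, a <= x <= b -> is_derive x (1 : R) F (f x)) ->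
  exists2 c, a < c < b & F b - F a = f c * (b - a).
Proof.
move=> ab dF.
have [||c] := @MVT _ F f a b ab.
- by move=> x; rewrite in_itv /= => /andP[ax xb]; apply: dF; rewrite !ltW.
- exact: is_derive_within_cts dF.
- by rewrite in_itv /=; exists c.
Qed.

Lemma is_derive_le0_nincr F f a b : a <= b ->
  (forall x, a <= x <= b -> is_derive x (1 : R) F (f x)) ->
  (forall x, a <= x <= b -> f x <= 0) -> F b <= F a.
Proof.
rewrite le_eqVlt => /predU1P[->//|ab] dF f0.
have [c /andP[ac cb] E] := MVT_is_derive ab dF.
rewrite -subr_le0 E mulr_le0_ge0 ?f0 ?subr_ge0; rewrite ?(ltW ac) ?(ltW cb)//.
exact: ltW.
Qed.

Lemma is_derive0_cst F a b : a <= b ->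
  (forall x, a <= x <= b -> is_derive x (1 : R) F 0) -> F a = F b.
Proof.
rewrite le_eqVlt => /predU1P[->//|ab] dF.
have [c _ /eqP] := @MVT_is_derive F (fun=> 0) _ _ ab dF.
by rewrite mul0r subr_eq0 => /eqP.
Qed.

Lemma Rintegral_is_derive F f a b : a <= b ->
  (forall x, a <= x <= b -> is_derive x (1 : R) F (f x)) ->
  {within `[a, b], continuous f} ->
  \int[mu]_(x in `[a, b]) f x = F b - F a.
Proof.
rewrite le_eqVlt => /predU1P[->|ab] dF cf.
  by rewrite set_itv1 Rintegral_set1 subrr.
have dFx x : x \in `]a, b[ -> is_derive x (1 : R) F (f x).
  by rewrite in_itv /= => /andP[ax xb]; apply: dF; rewrite !ltW.
have := @continuous_FTC2 _ f F a b ab cf.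
rewrite /Rintegral => -> //.
- split.
  + by move=> x /dFx[].
  + apply: cvg_at_right_filter; apply: is_derive_cts (dF a _).
    by rewrite lexx ltW.
  + apply: cvg_at_left_filter; apply: is_derive_cts (dF b _).
    by rewrite lexx ltW.
- by move=> x /dFx[_ dx]; rewrite derive1E.
Qed.

Lemma lipschitz_within_cts f a b M :
  (forall x y, a <= x <= b -> a <= y <= b -> `|f x - f y| <= M * `|x - y|) ->
  {within `[a, b], continuous f}.
Proof.
move=> H; apply/subspace_continuousP => x; rewrite /= in_itv /= => xab.
apply/cvgrPdist_le => e e0; have M1 : 0 < `|M| + 1 by rewrite ltr_wpDl.
rewrite near_withinE; near=> y => /=; rewrite in_itv /= => yab.
apply: le_trans (H _ _ xab yab) _.
have : `|x - y| <= e / (`|M| + 1).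
  by near: y; apply: cvgr_dist_le; [exact: cvg_id|rewrite divr_gt0].
rewrite ler_pdivlMr//; apply: le_trans.
rewrite mulrC ler_wpM2l//.
by apply: le_trans (ler_norm _) _; rewrite lerDl.
Unshelve. all: by end_near. Qed.

Lemma continuous_segment_integrable f a b :
  {within `[a, b], continuous f} -> mu.-integrable `[a, b] (EFin \o f).
Proof.
by move=> cf; apply: continuous_compact_integrable => //; exact: segment_compact.
Qed.

End calculus.

(** * Entire power series *)

Section entire_series.
Variable R : realType.
Implicit Types (c d : nat -> R) (z : R).

(** A growth condition that is visibly stable under shifts, linear combinations
    and termwise differentiation, so that every series below converges and is
    differentiable on the whole line without any discussion of radii. *)
Definition entire_coef c := exists M r : R,
  [/\ 0 <= M, 1 <= r & forall k, `|c k| <= M * r ^+ k / k`!%:R].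

Definition psum c z : R := limn (pseries c z).

Lemma entire_coef_cvg c z : entire_coef c -> cvgn (pseries c z).
Proof.
move=> [M [r [M0 r1 cM]]].
apply: normed_cvg.
apply: (@series_le_cvg _ _ (fun k => M * exp_coeff (r * `|z|) k)) => //.
- by move=> k /=.
- move=> k; apply: mulr_ge0 => //; apply: exp_coeff_ge0.
  by apply: mulr_ge0 => //; exact: le_trans r1.
- move=> k; rewrite /exp_coeff /= normrM normrX exprMn.
  apply: le_trans (ler_wpM2r _ (cM k)) _; first by rewrite exprn_ge0.
  by rewrite le_eqVlt; apply/orP; left; apply/eqP; ring.
- rewrite (_ : (fun _ => _) = M *: exp_coeff (r * `|z|))//.
  exact/is_cvg_seriesZ/is_cvg_series_exp_coeff.
Qed.

Lemma entire_coefD c d : entire_coef c -> entire_coef d ->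
  entire_coef (fun k => c k + d k).
Proof.
move=> [M [r [M0 r1 cM]]] [N [s [N0 s1 dN]]].
exists (M + N), (r * s); split; first exact: addr_ge0.
  by rewrite -[1]mulr1 ler_pM.
move=> k; apply: le_trans (ler_normD _ _) _.
have f0 : 0 <= (k`!%:R : R)^-1 by rewrite invr_ge0 ler0n.
have r0 : 0 <= r ^+ k by rewrite exprn_ge0// (le_trans ler01).
have s0 : 0 <= s ^+ k by rewrite exprn_ge0// (le_trans ler01).
have rk : 1 <= r ^+ k by rewrite exprn_ege1.
have sk : 1 <= s ^+ k by rewrite exprn_ege1.
rewrite mulrDl mulrDl; apply: lerD.
  apply: le_trans (cM k) _; rewrite ler_wpM2r// ler_wpM2l// exprMn.
  by rewrite ler_peMr.
apply: le_trans (dN k) _; rewrite ler_wpM2r// ler_wpM2l// exprMn.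
by rewrite ler_peMl.
Qed.

Lemma entire_coefZ a c : entire_coef c -> entire_coef (fun k => a * c k).
Proof.
move=> [M [r [M0 r1 cM]]]; exists (`|a| * M), r; split => //.
  exact: mulr_ge0.
by move=> k; rewrite normrM -!mulrA ler_wpM2l// !mulrA.
Qed.

Lemma entire_coef_shift c : entire_coef c -> entire_coef (fun k => c k.+1).
Proof.
move=> [M [r [M0 r1 cM]]]; exists (M * r), r; split => //.
  by rewrite mulr_ge0// (le_trans ler01).
move=> k; apply: le_trans (cM k.+1) _.
rewrite exprS mulrA ler_wpM2l//; last first.
  by rewrite lef_pV2 ?posrE ?ltr0n ?fact_gt0// ler_nat leq_fact.
by rewrite !mulr_ge0// ?exprn_ge0// (le_trans ler01).
Qed.

Lemma entire_coef_diffs c : entire_coef c -> entire_coef (pseries_diffs c).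
Proof.
move=> [M [r [M0 r1 cM]]]; exists (M * r), r; split => //.
  by rewrite mulr_ge0// (le_trans ler01).
move=> k; rewrite /pseries_diffs normrM ger0_norm//.
apply: le_trans (ler_wpM2l _ (cM k.+1)) _ => //.
rewrite factS natrM exprS le_eqVlt; apply/orP; left; apply/eqP.
have k1 : k.+1%:R != 0 :> R by rewrite pnatr_eq0.
have f1 : k`!%:R != 0 :> R by rewrite pnatr_eq0 -lt0n fact_gt0.
by move: (k.+1%:R) (k`!%:R) k1 f1 => u v u0 v0; field; rewrite u0 v0.
Qed.

Lemma psumD c d z : entire_coef c -> entire_coef d ->
  psum (fun k => c k + d k) z = psum c z + psum d z.
Proof.
move=> ec ed; rewrite /psum -lim_seriesD; [|exact: entire_coef_cvg..].
by congr (limn (series _)); apply/funext => k /=; rewrite mulrDl.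
Qed.

Lemma psumZ a c z : entire_coef c -> psum (fun k => a * c k) z = a * psum c z.
Proof.
move=> ec; rewrite /psum -[RHS]/(a *: _) -lim_seriesZ; last exact: entire_coef_cvg.
by congr (limn (series _)); apply/funext => k /=; rewrite -mulrA.
Qed.

Lemma psum_shift c z : entire_coef c ->
  psum c z = c 0 + z * psum (fun k => c k.+1) z.
Proof.
move=> ec; have es := entire_coef_shift ec.
apply/cvg_lim => //; rewrite -cvg_shiftS /=.
rewrite (_ : (fun n => _) =
  (fun n => c 0%N + z * pseries (fun k => c k.+1) z n)); last first.
  apply/funext => n; rewrite /pseries /series /= big_nat_recl// expr0 mulr1.
  congr (_ + _); rewrite big_distrr /=; apply: eq_bigr => i _.
  by rewrite exprS; ring.
apply: cvgD; first exact: cvg_cst.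
apply: cvgM; [exact: cvg_cst|exact: entire_coef_cvg].
Qed.

Lemma psum_split n c z : entire_coef c ->
  psum c z = \sum_(k < n) c k * z ^+ k + z ^+ n * psum (fun k => c (n + k)%N) z.
Proof.
move=> ec; suff: entire_coef (fun k => c (n + k)%N) /\ psum c z =
  \sum_(k < n) c k * z ^+ k + z ^+ n * psum (fun k => c (n + k)%N) z by case.
elim: n => [|n [en IHn]]; first by rewrite big_ord0 add0r expr0 mul1r.
have := entire_coef_shift en.
rewrite (_ : (fun k => c (n + k.+1)%N) = (fun k => c (n.+1 + k)%N)); last first.
  by apply/funext => k; rewrite addSnnS.
move=> en1; split => //; rewrite IHn (psum_shift _ en) big_ord_recr /= addn0.
rewrite (_ : (fun k => c (n + k.+1)%N) = (fun k => c (n.+1 + k)%N)); last first.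
  by apply/funext => k; rewrite addSnnS.
by rewrite exprS; ring.
Qed.

Lemma ler_psum c d z : entire_coef c -> entire_coef d -> 0 <= z ->
  (forall k, c k <= d k) -> psum c z <= psum d z.
Proof.
move=> ec ed z0 cd; apply: lim_series_le; [exact: entire_coef_cvg..|].
by move=> k /=; rewrite ler_wpM2r// exprn_ge0.
Qed.

Lemma psum_ge0 c z : entire_coef c -> 0 <= z -> (forall k, 0 <= c k) ->
  0 <= psum c z.
Proof.
move=> ec z0 c0; apply: limr_ge; first exact: entire_coef_cvg.
by apply: nearW => n; rewrite sumr_ge0// => k _; rewrite mulr_ge0// exprn_ge0.
Qed.

Lemma psum_ge_term n c z : entire_coef c -> 0 <= z -> (forall k, 0 <= c k) ->
  c n * z ^+ n <= psum c z.
Proof.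
move=> ec z0 c0; rewrite (psum_split n.+1)// big_ord_recr /=.
rewrite -[leLHS]addr0 lerD//.
  by rewrite lerDr sumr_ge0// => k _; rewrite mulr_ge0// exprn_ge0.
rewrite mulr_ge0// ?exprn_ge0// psum_ge0//.
elim: (n.+1) {c0} => // k IHk; have := entire_coef_shift IHk.
by congr entire_coef; apply/funext => j; rewrite addSnnS.
Qed.

Lemma is_derive_psum c z : entire_coef c ->
  is_derive z (1 : R) (psum c) (psum (pseries_diffs c) z).
Proof.
move=> ec; have ed := entire_coef_diffs ec.
apply: (@pseries_snd_diffs _ c (`|z| + 1)); do ?exact: entire_coef_cvg.
  exact/entire_coef_cvg/entire_coef_diffs.
by rewrite [ltRHS]ger0_norm ?addr_ge0// ltrDl.
Qed.

End entire_series.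

(** * The series behind the solutions of Hermite's equation *)

Section kummer.
Variable R : realType.
Implicit Types (a z : R) (i k n : nat).

Definition poch a n : R := \prod_(j < n) (a + j%:R).

Definition kcoef i a k : R := poch a k * 4 ^+ k / (2 * k + i)`!%:R.

(** For [i = 0] and [i = 1] this is Kummer's function [1F1(a; i + 1/2; z)]; the
    higher [i] are the tails of these two up to a shift of [a], and differentiating
    [x ^+ i.+1 * kummer i.+1 a (x ^+ 2)] gives [x ^+ i * kummer i a (x ^+ 2)]. *)
Definition kummer i a z := psum (kcoef i a) z.

Lemma poch0 a : poch a 0 = 1.
Proof. by rewrite /poch big_ord0. Qed.

Lemma pochS a n : poch a n.+1 = poch a n * (a + n%:R).
Proof. by rewrite /poch big_ord_recr. Qed.

Lemma pochD a m n : poch a (m + n) = poch a m * poch (a + m%:R) n.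
Proof.
elim: n => [|n IHn]; first by rewrite addn0 poch0 mulr1.
by rewrite addnS !pochS IHn natrD addrA mulrA.
Qed.

Lemma poch1 n : poch 1 n = n`!%:R.
Proof.
elim: n => [|n IHn]; first by rewrite poch0.
by rewrite pochS IHn factS natrM mulrC -nat1r.
Qed.

Lemma poch_ge0 a n : 0 <= a -> 0 <= poch a n.
Proof. by move=> a0; apply: prodr_ge0 => j _; rewrite addr_ge0. Qed.

Lemma poch_gt0 a n : 0 < a -> 0 < poch a n.
Proof. by move=> a0; apply: prodr_gt0 => j _; rewrite ltr_wpDr. Qed.

Lemma normr_poch_le a n : `|poch a n| <= (1 + `|a|) ^+ n * n`!%:R.
Proof.
elim: n => [|n IHn]; first by rewrite poch0 normr1 expr0 mul1r.
rewrite pochS normrM factS natrM exprS.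
have an : `|a + n%:R| <= (1 + `|a|) * n.+1%:R.
  rewrite (le_trans (ler_normD _ _))// normr_nat -nat1r.
  have : 0 <= `|a| * n%:R by rewrite mulr_ge0.
  by have := normr_ge0 a; have : 0 <= n%:R :> R by []; lra.
apply: le_trans (ler_pM _ _ IHn an) _ => //.
by rewrite le_eqVlt; apply/orP; left; apply/eqP; ring.
Qed.

Lemma factXfact_le k : (k`! * k`! <= (2 * k)`!)%N.
Proof.
elim: k => // k IHk.
rewrite (_ : 2 * k.+1 = (2 * k).+2)%N; last by lia.
rewrite !factS; move: k`! (2 * k)`! IHk => u v uv.
by nia.
Qed.

Lemma entire_kcoef i a : entire_coef (kcoef i a).
Proof.
exists 1, ((1 + `|a|) * 4); split => //.
  by have := normr_ge0 a; lra.
move=> k; rewrite mul1r /kcoef normrM normfV normrM normr_nat.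
rewrite ler_pdivrMr ?ltr0n ?fact_gt0//.
rewrite (ger0_norm (exprn_ge0 _ _))// exprMn.
rewrite [leRHS](_ : _ = (1 + `|a|) ^+ k * (k`!%:R^-1 * (2 * k + i)`!%:R) * 4 ^+ k);
  last by ring.
rewrite ler_wpM2r ?exprn_ge0//.
apply: le_trans (normr_poch_le a k) _.
rewrite ler_wpM2l ?exprn_ge0 ?addr_ge0//.
rewrite -ler_pdivrMl ?invr_gt0 ?ltr0n ?fact_gt0// invrK -natrM ler_nat.
by apply: leq_trans (factXfact_le k) _; rewrite leq_fact// leq_addr.
Qed.
Local Hint Resolve entire_kcoef : core.

Lemma fact_gt0R n : 0 < n`!%:R :> R.
Proof. by rewrite ltr0n fact_gt0. Qed.

Let fact_neq0 n : n`!%:R != 0 :> R.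
Proof. exact/lt0r_neq0/fact_gt0R. Qed.

Lemma kummer_gt0 i a z : 0 <= a -> 0 <= z -> 0 < kummer i a z.
Proof.
move=> a0 z0; apply: (@lt_le_trans _ _ (kcoef i a 0 * z ^+ 0)); last first.
  apply: psum_ge_term => // k.
  by rewrite /kcoef mulr_ge0 ?invr_ge0// mulr_ge0 ?exprn_ge0// poch_ge0.
by rewrite /kcoef poch0 !expr0 muln0 mul1r mulr1 mul1r invr_gt0 ltr0n fact_gt0.
Qed.

Lemma is_derive_kummer i a z :
  is_derive z (1 : R) (kummer i a) (psum (pseries_diffs (kcoef i a)) z).
Proof. exact: is_derive_psum. Qed.

(** This relation and the next close the pair of indices [0] and [1] under
    differentiation in [x], which is all that Hermite's equation asks for. *)
Lemma kummer0_derive a z :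
  2 * psum (pseries_diffs (kcoef 0 a)) z =
  2 * kummer 0 a z + (4 * a - 2) * kummer 1 a z.
Proof.
rewrite -!psumZ//; last exact: entire_coef_diffs.
rewrite -psumD//; [|exact: entire_coefZ..].
congr (psum _ z); apply/funext => k.
rewrite /pseries_diffs /kcoef pochS exprS.
rewrite (_ : 2 * k.+1 + 0 = (2 * k + 1).+1)%N; last by lia.
rewrite !addn0 addn1 !factS !natrM.
have -> : (2 * k).+2%:R = 2 * k.+1%:R :> R by rewrite -natrM; congr _%:R; lia.
have -> : (2 * k).+1%:R = 2 * k%:R + 1 :> R.
  by rewrite -natrM natr1.
have k1 : k.+1%:R != 0 :> R by rewrite pnatr_eq0.
have k2 : 2 * k%:R + 1 != 0 :> R by rewrite -natrM natr1 pnatr_eq0.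
move: (fact_neq0 (2 * k)) k1 k2.
by move: ((2 * k)`!%:R) (k.+1%:R) => u v u0 v0 w0; field; rewrite u0 v0 w0.
Qed.

Lemma kummer1_derive a z :
  kummer 1 a z + 2 * z * psum (pseries_diffs (kcoef 1 a)) z = kummer 0 a z.
Proof.
have es i : entire_coef (fun k => kcoef i a k.+1) by exact: entire_coef_shift.
rewrite /kummer (psum_shift _ (entire_kcoef 1 a)) (psum_shift _ (entire_kcoef 0 a)).
have -> : kcoef 1 a 0 = kcoef 0 a 0.
  by rewrite /kcoef muln0.
rewrite -addrA; congr (_ + _).
rewrite -[2 * z]mulrC -mulrA -mulrDr; congr (_ * _).
rewrite -psumZ//; last exact: entire_coef_diffs.
rewrite -psumD//; last exact/entire_coefZ/entire_coef_diffs.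
congr (psum _ z); apply/funext => k.
rewrite /pseries_diffs /kcoef.
rewrite addn0 addn1 factS natrM.
have -> : (2 * k.+1).+1%:R = 1 + 2 * k.+1%:R :> R.
  by rewrite -natrM nat1r.
have k2 : 1 + 2 * k.+1%:R != 0 :> R by rewrite -natrM nat1r pnatr_eq0.
move: (fact_neq0 (2 * k.+1)) k2.
by move: ((2 * k.+1)`!%:R) (k.+1%:R) => u v u0 v0; field; rewrite u0 v0.
Qed.

(** At parameter [1] the functions [x ^+ i * kummer i 1 (x ^+ 2)] are repeated
    integrals of one function, and like those of the complementary error function
    they satisfy a three-term recurrence. *)
Lemma kummer_recurrence i z :
  kummer i 1 z + 2 * i%:R * z * kummer i.+2 1 z
  = (i`!%:R)^-1 + 2 * z * kummer i.+1 1 z.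
Proof.
have es j : entire_coef (fun k => kcoef j 1 k.+1) by exact: entire_coef_shift.
rewrite {1}/kummer (psum_shift _ (entire_kcoef i 1)).
have -> : kcoef i 1 0 = (i`!%:R)^-1 by rewrite /kcoef poch0 expr0 muln0 !mul1r.
rewrite -addrA; congr (_ + _).
rewrite [2 * i%:R * z]mulrC [2 * z]mulrC -!mulrA -mulrDr; congr (_ * _).
rewrite mulrA -!psumZ// -psumD//; last exact: entire_coefZ.
congr (psum _ z); apply/funext => k.
rewrite /kcoef !poch1 exprS factS natrM.
rewrite (_ : 2 * k.+1 + i = (2 * k + i).+2)%N; last by lia.
rewrite (_ : 2 * k + i.+1 = (2 * k + i).+1)%N; last by lia.
rewrite (_ : 2 * k + i.+2 = (2 * k + i).+2)%N; last by lia.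
rewrite (factS (2 * k + i).+1) natrM.
have -> : (2 * k + i).+2%:R = 2 * k.+1%:R + i%:R :> R.
  by rewrite -natrM -natrD; congr _%:R; lia.
have k2 : 2 * k.+1%:R + i%:R != 0 :> R.
  by rewrite -natrM -natrD pnatr_eq0; lia.
move: (fact_neq0 (2 * k + i).+1) k2.
by move: (_`!%:R) (k.+1%:R) => u v u0 v0; field; rewrite u0 v0.
Qed.

(** The factors of the Pochhammer symbol beyond the [n]-th are those of a symbol
    at [a + n%:R], so a tail is again a series of the family. *)
Lemma kummer_split n i a z :
  kummer i a z = \sum_(k < n) kcoef i a k * z ^+ k
    + poch a n * (4 * z) ^+ n * kummer (2 * n + i) (a + n%:R) z.
Proof.
rewrite {1}/kummer (psum_split n)//; congr (_ + _).
rewrite (_ : (fun k => _) = (fun k => poch a n * 4 ^+ n *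
    kcoef (2 * n + i) (a + n%:R) k)); last first.
  apply/funext => k; rewrite /kcoef pochD exprD.
  rewrite (_ : 2 * (n + k) + i = 2 * k + (2 * n + i))%N; last by lia.
  by ring.
by rewrite psumZ// exprMn -/(kummer _ _ _); ring.
Qed.

End kummer.

(** * Growth of the series at parameter 1 *)

Section gauss_kummer.
Variable R : realType.
Implicit Types (x z : R).

Let B x := x * kummer 1 1 (x ^+ 2) * expR (- x ^+ 2).

Lemma is_derive_kummer_sqr i (a : R) x :
  is_derive x (1 : R) (fun x => kummer i a (x ^+ 2))
    (2 * x * psum (pseries_diffs (kcoef i a)) (x ^+ 2)).
Proof.
have dk := is_derive_kummer i a (x ^+ 2).
have -> : (fun x => kummer i a (x ^+ 2)) = kummer i a \o (fun x => x ^+ 2) by [].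
apply: is_derive_eq.
by rewrite /GRing.scale /=; ring.
Qed.

(** [x * kummer 1 1 (x ^+ 2)] is [exp (x ^ 2)] times the Gaussian integral from
    [0] to [x]: both solve [y' = 2 x y + 1], [y 0 = 0]. *)
Lemma is_derive_gauss_kummer x : is_derive x (1 : R) B (expR (- x ^+ 2)).
Proof.
have dk := is_derive_kummer_sqr 1 1 x.
have de : is_derive x (1 : R) (fun x => expR (- x ^+ 2))
    (expR (- x ^+ 2) * (- (2 * x))).
  have -> : (fun x => expR (- x ^+ 2)) = expR \o (fun x : R => - x ^+ 2) by [].
  apply: is_derive_eq.
  by rewrite /GRing.scale /=; ring.
rewrite /B; apply: is_derive_eq.
rewrite /GRing.scale /= mulr1.
have := kummer1_derive 1 (x ^+ 2).
have := kummer_recurrence 0 (x ^+ 2).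
rewrite mulr0 !mul0r addr0 fact0 invr1.
set D := psum _ _; set K := kummer 1 1 _; set L := kummer 0 1 _ => LE KE.
have -> : x * (2 * x * D) = L - K by rewrite -KE; ring.
by rewrite LE; ring.
Qed.

Lemma gauss_kummer_integral x : 0 <= x ->
  \int[lebesgue_measure]_(t in `[0, x]) gauss_fun t = B x.
Proof.
move=> x0.
have dB y : 0 <= y <= x -> is_derive y (1 : R) B (gauss_fun y).
  by move=> _; exact: is_derive_gauss_kummer.
have -> := Rintegral_is_derive x0 dB; first by rewrite /B !mul0r subr0.
by apply: continuous_subspaceT; exact: continuous_gauss_fun.
Qed.

Lemma cvg_gauss_kummer : B x @[x --> +oo] --> Num.sqrt pi / 2.
Proof.
have -> : Num.sqrt pi / 2 = Num.sqrt (pi / 4) :> R.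
  rewrite sqrtrM ?pi_ge0// sqrtrV// (_ : 4 = 2 ^+ 2); last by rewrite -natrX.
  by rewrite sqrtr_sqr ger0_norm.
have : Num.sqrt (gauss_integral_proof.integral0_gauss x ^+ 2) @[x --> +oo]
    --> Num.sqrt (pi / 4 : R).
  apply: continuous_cvg; first exact: sqrt_continuous.
  exact: gauss_integral_proof.cvg_integral0_gauss_sqr.
apply: cvg_trans; apply: near_eq_cvg; near=> x.
have x0 : 0 <= x by near: x; exact: nbhs_pinfty_ge.
rewrite sqrtr_sqr ger0_norm; last exact: gauss_integral_proof.integral0_gauss_ge0.
by rewrite -gauss_kummer_integral.
Unshelve. all: by end_near. Qed.

Lemma expRN_le x : 0 < x -> expR (- x) <= 2 / x ^+ 2.
Proof.
move=> x0; rewrite expRN -[leRHS]invrK lef_pV2 ?posrE ?expR_gt0//; last first.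
  by rewrite invr_gt0 divr_gt0// exprn_gt0.
rewrite invfM invrK mulrC; apply: le_trans (expR_ge1Dxn 1 (ltW x0)).
by rewrite -[leLHS]add0r lerD.
Qed.

(** The function increases to its limit, and it approaches it fast because adding
    [x ^- 2] makes it decrease: the Gaussian is smaller than [2 / x ^ 3]. *)
Lemma gauss_kummer_asymp x : 1 <= x -> `|B x - Num.sqrt pi / 2| <= 1 / x ^+ 2.
Proof.
move=> x1; have x0 : 0 < x by rewrite (lt_le_trans ltr01).
have Bmono y z : x <= y -> y <= z -> B y <= B z.
  move=> xy yz; rewrite -lerN2; apply: (@is_derive_le0_nincr _ (- B) _ _ _ yz).
    by move=> t _; have := is_derive_gauss_kummer t; exact: is_deriveN.
  by move=> t _; rewrite oppr_le0 expR_ge0.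
have Banti y z : x <= y -> y <= z -> B z + (z ^+ 2)^-1 <= B y + (y ^+ 2)^-1.
  move=> xy yz.
  apply: (@is_derive_le0_nincr _ (fun t => B t + (t ^+ 2)^-1)
    (fun t => expR (- t ^+ 2) - 2 * t / (t ^+ 2) ^+ 2) _ _ yz) => t /andP[yt tz];
    have t0 : 0 < t by lra.
    have dB := is_derive_gauss_kummer t.
    have t2 : t ^+ 2 != 0 by rewrite expf_neq0// gt_eqF.
    have dI : is_derive t (1 : R) (fun t => (t ^+ 2)^-1) (- (2 * t / (t ^+ 2) ^+ 2)).
      have d2 : is_derive t (1 : R) (fun t => t ^+ 2) (2 * t).
        by apply: is_derive_eq; rewrite /GRing.scale /=; ring.
      have dV := @is_deriveV _ (fun t => t ^+ 2) _ _ _ t2 d2.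
      apply: (is_derive_eq dV); rewrite /GRing.scale /=.
      by move: t2; rewrite sqrf_eq0 => t1; field.
    exact: is_derive_eq.
  rewrite subr_le0; apply: le_trans (expRN_le (exprn_gt0 2 t0)) _.
  rewrite ler_wpM2r// ?invr_ge0 ?exprn_ge0 ?(ltW t0)//; lra.
have cv : cvg (B y @[y --> +oo]).
  by apply/cvg_ex; exists (Num.sqrt pi / 2); exact: cvg_gauss_kummer.
have limB : lim (B y @[y --> +oo]) = Num.sqrt pi / 2.
  exact: cvg_lim cvg_gauss_kummer.
have lo : B x <= Num.sqrt pi / 2.
  rewrite -limB; apply: limr_ge => //.
  near=> y; apply: Bmono (lexx x) _.
  by near: y; exact/nbhs_pinfty_ge/num_real.
have up : Num.sqrt pi / 2 <= B x + (x ^+ 2)^-1.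
  rewrite -limB; apply: limr_le => //; near=> y.
  have xy : x <= y by near: y; exact/nbhs_pinfty_ge/num_real.
  apply: le_trans (Banti x y (lexx _) xy).
  by rewrite lerDl invr_ge0 exprn_ge0// (le_trans _ xy)// ltW.
by rewrite ler_norml div1r; apply/andP; split; lra.
Unshelve. all: by end_near. Qed.

End gauss_kummer.

Section kummer_growth.
Variable R : realType.
Implicit Types (x z d : R) (i k n p : nat).
Local Hint Resolve entire_kcoef : core.

Lemma kcoef_ge0 i (a : R) k : 0 <= a -> 0 <= kcoef i a k.
Proof. by move=> a0; rewrite /kcoef mulr_ge0 ?invr_ge0// mulr_ge0 ?poch_ge0. Qed.

Lemma kummer_ge_coef k i (a : R) z : 0 <= a -> 0 <= z ->
  kcoef i a k * z ^+ k <= kummer i a z.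
Proof. by move=> a0 z0; apply: psum_ge_term => // j; exact: kcoef_ge0. Qed.

Let kummer_add2 i z : 0 <= z ->
  z ^+ 2 * kummer i.+2 1 z <= (i + 4)%:R ^+ 2 * kummer i 1 z.
Proof.
move=> z0.
have e2 : entire_coef (fun k => kcoef i (1 : R) (2 + k)%N).
  have e1 := entire_coef_shift (entire_kcoef i (1 : R)).
  exact: entire_coef_shift e1.
rewrite {2}/kummer (psum_split 2)// mulrDr ler_wpDl//.
  rewrite mulr_ge0 ?exprn_ge0// sumr_ge0// => k _.
  by rewrite mulr_ge0 ?kcoef_ge0// exprn_ge0.
rewrite mulrCA ler_wpM2l ?exprn_ge0// -psumZ//.
apply: ler_psum => //; first exact: entire_coefZ.
move=> k; rewrite /kcoef !poch1.
rewrite (_ : 2 * (2 + k) + i = (2 * k + i.+2).+2)%N; last by lia.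
rewrite !factS exprD !natrM invfM (invfM _ (_`!%:R)).
set w := k`!%:R; set v := ((2 * k + i.+2)`!%:R)^-1.
have w0 : 0 < w by exact: fact_gt0R.
have v0 : 0 < v by rewrite invr_gt0.
set a := (2 * k + i.+2).+2%:R; set b := (2 * k + i.+2).+1%:R.
have a0 : 0 < a by rewrite ltr0n.
have b0 : 0 < b by rewrite ltr0n.
rewrite [leRHS](_ : _ = w * 4 ^+ k * v *
  ((i + 4)%:R ^+ 2 * (k.+2%:R * k.+1%:R) * 16 / (a * b))); last first.
  move: (i + 4)%:R k.+2%:R k.+1%:R w v a b a0 b0 {w0 v0} => r s t w v a b.
  by move=> /lt0r_neq0 a0 /lt0r_neq0 b0; field; rewrite b0 a0.
rewrite ler_peMr//; first by rewrite !mulr_ge0 ?ltW ?exprn_gt0.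
rewrite ler_pdivlMr ?mulr_gt0// mul1r /a /b -natrX -!natrM ler_nat.
by nia.
Qed.

Let kummer_ge_inv_fact i z : 0 <= z ->
  z * (i`!%:R)^-1 <= (i + 4)%:R ^+ 2 * kummer i 1 z.
Proof.
move=> z0.
apply: le_trans (ler_wpM2l _ (kummer_ge_coef 1 i ler01 z0)); last first.
  by rewrite exprn_ge0.
rewrite /kcoef poch1 (_ : 1`! = 1)%N// !expr1 mul1r [_ * z]mulrC mulrCA ler_wpM2l//.
rewrite (_ : 2 * 1 + i = i.+2)%N; last by lia.
rewrite !factS !natrM.
set u := i`!%:R; have u0 : 0 < u by exact: fact_gt0R.
set a := i.+2%:R; set b := i.+1%:R.
have a0 : 0 < a by rewrite ltr0n.
have b0 : 0 < b by rewrite ltr0n.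
rewrite [leRHS](_ : _ = u^-1 * ((i + 4)%:R ^+ 2 * 4 / (a * b))); last first.
  move: (i + 4)%:R u a b u0 a0 b0 => r u a b.
  by move=> /lt0r_neq0 u0 /lt0r_neq0 a0 /lt0r_neq0 b0; field; rewrite b0 a0 u0.
rewrite ler_peMr//; first by rewrite invr_ge0 ltW.
rewrite ler_pdivlMr ?mulr_gt0// mul1r /a /b -natrX -!natrM ler_nat.
by nia.
Qed.

(** Termwise comparison makes both correction terms of the three-term recurrence
    smaller than the main term by a factor of order [1 / z], so that raising the
    index divides the series by [2 z] to leading order. *)
Lemma kummer_step i : exists2 c : R, 0 < c & forall z, 0 < z ->
  `|2 * z * kummer i.+1 1 z - kummer i 1 z| <= c / z * kummer i 1 z.
Proof.
exists ((2 * i%:R + 1) * (i + 4)%:R ^+ 2).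
  by rewrite mulr_gt0 ?exprn_gt0 ?ltr0n ?addn4// ltr_wpDl ?mulr_ge0.
move=> z z0.
have z0' := ltW z0.
rewrite (_ : _ - _ = 2 * i%:R * z * kummer i.+2 1 z - (i`!%:R)^-1); last first.
  have := kummer_recurrence i z; lra.
apply: le_trans (ler_normB _ _) _.
have K0 : 0 <= kummer i.+2 1 z by rewrite ltW// kummer_gt0.
have f0 : 0 <= (i`!%:R : R)^-1 by rewrite invr_ge0.
rewrite !ger0_norm ?mulr_ge0//.
rewrite [leRHS]mulrAC ler_pdivlMr//.
have := kummer_add2 i z0'; have := kummer_ge_inv_fact i z0'.
set A := kummer _ _ _ => H1 H2.
have i2 : 0 <= 2 * i%:R :> R by rewrite mulr_ge0.
have := ler_wpM2l i2 H2; lra.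
Qed.

(** The Gaussian integral gives index [1]; each further index costs a factor
    [2 * z] and a relative error of order [1 / z]. *)
Lemma kummer1_asymp i : exists2 C : R, 0 < C & forall x, 1 <= x ->
  `|kummer i.+1 1 (x ^+ 2) * (2 * x ^+ 2) ^+ i * x * expR (- x ^+ 2)
     - Num.sqrt pi / 2| <= C / x ^+ 2.
Proof.
elim: i => [|i [C C0 IHi]].
  exists 1 => // x x1; rewrite expr0 mulr1 [_ * x]mulrC.
  exact: gauss_kummer_asymp.
have [c c0 cK] := kummer_step i.+1.
have sp0 : 0 <= Num.sqrt pi / 2 :> R by rewrite divr_ge0// sqrtr_ge0.
exists (C + c * (Num.sqrt pi / 2 + C)).
  by rewrite ltr_wpDr// mulr_ge0 ?addr_ge0 ?(ltW c0) ?(ltW C0).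
move=> x x1; have x0 : 0 < x by rewrite (lt_le_trans ltr01).
have x2 : 1 <= x ^+ 2 by rewrite exprn_ege1.
have z0 : 0 < x ^+ 2 by rewrite exprn_gt0.
have := IHi x x1; have := cK _ z0.
rewrite [_ ^+ i.+1]exprS.
move: (x ^+ 2) x2 z0 => z z1 z0.
have i0 : 0 <= kummer i.+1 1 z by rewrite ltW// kummer_gt0// ltW.
move: (kummer i.+1 1 z) (kummer i.+2 1 z) i0 => A A' A0.
set s := Num.sqrt pi / 2; set E := expR _.
have E0 : 0 < E by exact: expR_gt0.
set P := (2 * z) ^+ i.
have P0 : 0 < P by rewrite exprn_gt0// mulr_gt0.
move=> H1 H2.
have iz0 : 0 < z^-1 by rewrite invr_gt0.
have iz1 : z^-1 <= 1 by rewrite invf_le1.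
set N := A * P * x * E in H2.
have N0 : 0 <= N by rewrite /N !mulr_ge0 // ltW.
have Nle : N <= s + C.
  move: H2; rewrite ler_norml => /andP[_ H2].
  have : C / z <= C by rewrite ler_piMr// ltW.
  lra.
have H3 : `|A' * (2 * z * P) * x * E - N| <= c / z * N.
  rewrite (_ : _ - _ = (2 * z * A' - A) * (P * x * E)); last by rewrite /N; ring.
  rewrite normrM (ger0_norm (_ : 0 <= P * x * E)); last by rewrite !mulr_ge0// ltW.
  rewrite /N (_ : c / z * (A * P * x * E) = (c / z * A) * (P * x * E)); last by ring.
  by rewrite ler_wpM2r// !mulr_ge0// ltW.
have H4 : c / z * N <= c * (s + C) / z.
  rewrite mulrAC; apply: ler_wpM2r; first exact: ltW.
  by apply: ler_wpM2l; first exact: ltW.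
move: H2 H3; rewrite !ler_norml mulrDl => /andP[h1 h2] /andP[h3 h4].
by apply/andP; split; lra.
Qed.

End kummer_growth.

(** * Zeros in the parameter *)

Section parameter_zeros.
Variable R : realType.
Implicit Types (x z d : R) (i j k : nat).
Local Hint Resolve entire_kcoef : core.

Lemma poch_neg j d : poch (- j%:R - d) j = (-1) ^+ j * poch (1 + d) j.
Proof.
elim: j => [|j IHj]; first by rewrite !poch0 mulr1.
rewrite -add1n pochD.
rewrite (_ : - (1 + j)%:R - d + 1%:R = - j%:R - d); last by rewrite natrD; ring.
rewrite IHj pochS poch0 add1n pochS exprS -nat1r.
by rewrite mulr0n addr0; ring.
Qed.

Let poch1D_ge1 j d : 0 <= d -> 1 <= poch (1 + d) j.
Proof.
move=> d0; elim: j => [|j IHj]; first by rewrite poch0.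
rewrite pochS; apply: le_trans IHj _; rewrite ler_peMr//.
  by rewrite poch_ge0// addr_ge0.
by rewrite -addrA lerDl addr_ge0.
Qed.

Let poch1D_le j d : 0 <= d <= 1 -> poch (1 + d) j <= j.+1`!%:R.
Proof.
move=> /andP[d0 d1]; elim: j => [|j IHj]; first by rewrite poch0.
rewrite pochS factS natrM mulrC; apply: ler_pM => //.
- by rewrite !addr_ge0.
- by rewrite poch_ge0// addr_ge0.
- by rewrite -addn2 natrD; lra.
Qed.

Let poch1D_lipschitz j d1 d2 : 0 <= d1 <= 1 -> 0 <= d2 <= 1 ->
  `|poch (1 + d1) j - poch (1 + d2) j| <= (j * j.+1`!)%:R * `|d1 - d2|.
Proof.
move=> d1P d2P; elim: j => [|j IHj]; first by rewrite !poch0 subrr normr0 mul0r.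
rewrite !pochS (_ : _ - _ = (poch (1 + d1) j - poch (1 + d2) j) * (1 + d1 + j%:R)
  + poch (1 + d2) j * (d1 - d2)); last by ring.
apply: le_trans (ler_normD _ _) _; rewrite !normrM.
move: (d1P) (d2P) => /andP[d10 d11] /andP[d20 d21].
rewrite (ger0_norm (_ : 0 <= 1 + d1 + j%:R)); last by rewrite !addr_ge0.
rewrite (ger0_norm (_ : 0 <= poch (1 + d2) j)); last first.
  by rewrite poch_ge0// addr_ge0.
have A : 1 + d1 + j%:R <= j.+2%:R by rewrite -addn2 natrD; lra.
have J0 : 0 <= 1 + d1 + j%:R by rewrite !addr_ge0.
have H1 := ler_pM (normr_ge0 _) J0 IHj A.
have H2 := ler_wpM2r (normr_ge0 (d1 - d2)) (poch1D_le j d2P).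
apply: le_trans (lerD H1 H2) _.
rewrite mulrAC -mulrDl ler_wpM2r// -natrM -natrD ler_nat.
rewrite [j.+2`!]factS; move: (j.+1`!) => u; nia.
Qed.

(** In the parameter [1 - d], the series of index [i.+1] moves at most by the
    series of index [i]: the factor lost in differentiating the Pochhammer symbol
    is at most the summation index, which one derivative in [x] restores. *)
Lemma kummer_lipschitz i z d1 d2 : 0 <= z -> 0 <= d1 -> d1 <= d2 -> d2 <= 1 ->
  0 <= kummer i.+1 (1 - d1) z - kummer i.+1 (1 - d2) z
    <= (d2 - d1) / 2 * kummer i 1 z.
Proof.
move=> z0 d10 d12 d21.
have P0 d k : d <= 1 -> 0 <= poch (1 - d) k by move=> ?; rewrite poch_ge0// subr_ge0.
have Pf d k : 0 <= d -> d <= 1 -> poch (1 - d) k <= k`!%:R.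
  move=> e0 e1; elim: k => [|k IHk]; first by rewrite poch0.
  rewrite pochS factS natrM mulrC ler_pM ?P0//.
    by rewrite addr_ge0// subr_ge0.
  by rewrite -nat1r lerD2r gerBl.
have PL k : 0 <= poch (1 - d1) k - poch (1 - d2) k <= (k * k`!)%:R * (d2 - d1).
  elim: k => [|k /andP[IHk1 IHk2]]; first by rewrite !poch0 subrr mul0r lexx.
  rewrite !pochS (_ : _ - _ = (poch (1 - d1) k - poch (1 - d2) k) * (1 - d1 + k%:R)
    + poch (1 - d2) k * (d2 - d1)); last by ring.
  have e0 : 0 <= d2 - d1 by rewrite subr_ge0.
  have J0 : 0 <= 1 - d1 + k%:R by rewrite addr_ge0// subr_ge0 (le_trans d12).
  apply/andP; split; first by rewrite addr_ge0 ?mulr_ge0 ?P0.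
  have A : 1 - d1 + k%:R <= k.+1%:R by rewrite -nat1r lerD2r gerBl.
  have H1 := ler_pM IHk1 J0 IHk2 A.
  have H2 := ler_wpM2r e0 (Pf d2 k (le_trans d10 d12) d21).
  apply: le_trans (lerD H1 H2) _.
  rewrite mulrAC -mulrDl ler_wpM2r// -natrM -natrD ler_nat factS.
  by move: (k`!) => u; nia.
have eB : entire_coef (fun k => kcoef i.+1 (1 - d1) k + -1 * kcoef i.+1 (1 - d2) k).
  by apply: entire_coefD => //; exact: entire_coefZ.
have -> : kummer i.+1 (1 - d1) z - kummer i.+1 (1 - d2) z =
    psum (fun k => kcoef i.+1 (1 - d1) k + -1 * kcoef i.+1 (1 - d2) k) z.
  by rewrite psumD ?psumZ ?mulN1r//; exact: entire_coefZ.
rewrite -psumZ//.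
have W k : 0 <= 4 ^+ k / (2 * k + i.+1)`!%:R :> R by rewrite divr_ge0 ?exprn_ge0.
have E k : kcoef i.+1 (1 - d1) k + -1 * kcoef i.+1 (1 - d2) k =
    (poch (1 - d1) k - poch (1 - d2) k) * (4 ^+ k / (2 * k + i.+1)`!%:R).
  by rewrite /kcoef; ring.
apply/andP; split.
  apply: psum_ge0 => // k; rewrite E mulr_ge0//.
  by case/andP: (PL k).
apply: ler_psum => //; first exact: entire_coefZ.
move=> k; rewrite E.
case/andP: (PL k) => _ /(ler_wpM2r (W k)) /le_trans; apply.
rewrite /kcoef poch1 addnS factS !natrM.
set a := (2 * k + i).+1%:R; set b := (2 * k + i)`!%:R; set c := k`!%:R.
have a0 : 0 < a :> R by rewrite ltr0n.
have b0 : 0 < b :> R by exact: fact_gt0R.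
have c0 : 0 < c :> R by exact: fact_gt0R.
have ka : k%:R / a <= 2^-1 :> R.
  by rewrite ler_pdivrMr// mulrC ler_pdivlMr// -natrM ler_nat; lia.
have F0 : 0 <= (d2 - d1) * (c * 4 ^+ k / b).
  by rewrite mulr_ge0 ?subr_ge0// divr_ge0 ?mulr_ge0 ?exprn_ge0 ?ltW.
have := ler_wpM2l F0 ka.
rewrite (_ : (a * b)^-1 = a^-1 * b^-1); last exact: invfM.
rewrite -/c; clearbody a b c.
move: (4 ^+ k) (k%:R) a^-1 b^-1 => e K a' b'.
lra.
Qed.

(** Coefficients of the polynomial part of the series at [- n%:R - d], normalized
    by the last one. *)
Definition low_ratio j d : R := (-1) ^+ j / poch (1 + d) j.

Lemma normr_low_ratio_le1 j d : 0 <= d -> `|low_ratio j d| <= 1.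
Proof.
move=> d0; rewrite /low_ratio normrM normrX normrN1 expr1n mul1r normfV.
have := poch1D_ge1 j d0 => P1.
by rewrite ger0_norm ?invf_le1 ?(lt_le_trans _ P1)// (le_trans _ P1).
Qed.

Lemma low_ratio_lipschitz j d1 d2 : 0 <= d1 <= 1 -> 0 <= d2 <= 1 ->
  `|low_ratio j d1 - low_ratio j d2| <= (j * j.+1`!)%:R * `|d1 - d2|.
Proof.
move=> d1P d2P; have := poch1D_lipschitz j d1P d2P; apply: le_trans.
have [/andP[d10 _] /andP[d20 _]] := (d1P, d2P).
have P1 := poch1D_ge1 j d10; have P2 := poch1D_ge1 j d20.
rewrite /low_ratio -mulrBr normrM normrX normrN1 expr1n mul1r.
move: (poch (1 + d1) j) (poch (1 + d2) j) P1 P2 => u v u1 v1.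
have u0 : 0 < u by lra.
have v0 : 0 < v by lra.
have -> : u^-1 - v^-1 = (v - u) / (u * v).
  by move: u0 v0 => /lt0r_neq0 u0 /lt0r_neq0 v0; field; rewrite u0 v0.
have uv1 : 1 <= u * v by rewrite -[1]mulr1 ler_pM.
have uv0 : 0 < u * v by rewrite mulr_gt0.
rewrite normrM [X in X * _ <= _]distrC ler_piMr//.
by rewrite ger0_norm ?invf_le1// invr_ge0 ltW.
Qed.

End parameter_zeros.

Section eigenvalue_shift.
Variable R : realType.
Implicit Types (x z d : R) (i j k : nat).
Variables p n : nat.
Local Notation m := (2 * n + p)%N.

Definition low_part d z : R :=
  \sum_(k < n.+1) low_ratio (n - k) d * ((4 * z) ^+ k / (2 * k + p)`!%:R).

(** Beyond degree [n] all terms of the series at parameter [- n%:R - d] have the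
    same sign and carry the factor [d]; [low_part] is the rest. The zeros in [d] are
    where the two balance. *)
Definition balance d z : R :=
  d * (4 * z) ^+ n.+1 * kummer m.+2 (1 - d) z - low_part d z.

Lemma kummer_balance d z : 0 <= d ->
  kummer p (- n%:R - d) z = - poch (- n%:R - d) n * balance d z.
Proof.
move=> d0; rewrite (kummer_split n.+1).
rewrite (_ : 2 * n.+1 + p = m.+2)%N; last by lia.
rewrite pochS (_ : - n%:R - d + n%:R = - d); last by ring.
rewrite (_ : - n%:R - d + n.+1%:R = 1 - d); last by rewrite -nat1r; ring.
rewrite /balance mulrBr -[RHS]addrC; congr (_ + _); last by ring.
rewrite mulNr opprK /low_part mulr_sumr; apply: eq_bigr => -[k /= kS] _.
have kn : (k <= n)%N by rewrite -ltnS.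
have -> : poch (- n%:R - d) n =
    poch (- n%:R - d) k * ((-1) ^+ (n - k) * poch (1 + d) (n - k)).
  have := pochD (- n%:R - d) k (n - k); rewrite subnKC// => ->.
  by rewrite -poch_neg; congr (_ * poch _ _); rewrite natrB//; ring.
rewrite /kcoef /low_ratio exprMn.
have P1 : poch (1 + d) (n - k) != 0 by rewrite gt_eqF// poch_gt0// ltr_wpDr.
have S1 : (-1) ^+ (n - k) * (-1) ^+ (n - k) = 1 :> R.
  by rewrite -exprMn mulrNN mulr1 expr1n.
move: (poch (1 + d) _) ((-1) ^+ (n - k)) P1 S1 => u s u0 ss.
rewrite [RHS](_ : _ = poch (- n%:R - d) k * (s * s) * (u / u) *
  (4 ^+ k * z ^+ k / (2 * k + p)`!%:R)); last by ring.
by rewrite ss divff// !mulr1; ring.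
Qed.

Lemma poch_neg_neq0 d : 0 <= d -> poch (- n%:R - d) n != 0.
Proof.
by move=> d0; rewrite poch_neg mulf_neq0 ?signr_eq0// gt_eqF// poch_gt0// ltr_wpDr.
Qed.

Lemma kummer_eq0 d z : 0 <= d ->
  (kummer p (- n%:R - d) z = 0) <-> balance d z = 0.
Proof.
move=> d0; rewrite kummer_balance//; split => [/eqP|->]; last by rewrite mulr0.
by rewrite mulf_eq0 oppr_eq0 (negbTE (poch_neg_neq0 d0)) => /eqP.
Qed.

Let term_le z k : 1 <= z -> (k <= n)%N ->
  (4 * z) ^+ k / (2 * k + p)`!%:R <= 4 ^+ n * z ^+ k.
Proof.
move=> z1 kn; rewrite exprMn ler_pdivrMr//.
have z0 : 0 <= z ^+ k by rewrite exprn_ge0// (le_trans ler01).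
have k4 : 4 ^+ k <= 4 ^+ n :> R by rewrite ler_eXn2l// ltr1n.
apply: le_trans (ler_wpM2r z0 k4) _.
by rewrite ler_peMr ?mulr_ge0 ?(exprn_ge0 n)// ler1n fact_gt0.
Qed.

Let term_ge0 z k : 1 <= z -> 0 <= (4 * z) ^+ k / (2 * k + p)`!%:R.
Proof. by move=> z1; rewrite divr_ge0// exprn_ge0// mulr_ge0// (le_trans ler01). Qed.

Lemma low_part_lead : exists2 C : R, 0 < C & forall d z, 0 <= d -> 1 <= z ->
  `|low_part d z - (4 * z) ^+ n / m`!%:R| <= C / z * z ^+ n.
Proof.
exists ((n * 4 ^ n).+1%:R) => // d z d0 z1.
have z0 : 0 < z by rewrite (lt_le_trans ltr01).
rewrite /low_part big_ord_recr /= subnn /low_ratio expr0 poch0 divr1 mul1r addrK.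
apply: le_trans (ler_norm_sum _ _ _) _.
apply: (@le_trans _ _ (\sum_(k < n) 4 ^+ n * z ^+ n / z)).
  apply: ler_sum => k _; rewrite normrM (ger0_norm (term_ge0 _ z1)).
  apply: le_trans (ler_piMl (term_ge0 _ z1) (normr_low_ratio_le1 _ d0)) _.
  apply: le_trans (term_le z1 (ltnW (ltn_ord k))) _.
  rewrite -mulrA ler_wpM2l ?exprn_ge0// ler_pdivlMr// -exprSr.
  by rewrite ler_weXn2l.
rewrite sumr_const card_ord -[leLHS]mulr_natl.
rewrite [leLHS](_ : _ = (n * 4 ^ n)%:R * (z ^+ n / z)); last first.
  by rewrite natrM natrX; ring.
rewrite [leRHS]mulrAC -[leRHS]mulrA ler_wpM2r ?ler_nat//.
by rewrite divr_ge0 ?exprn_ge0// ltW.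
Qed.

Lemma low_part_lipschitz : exists2 L : R, 0 < L & forall d1 d2 z,
  0 <= d1 <= 1 -> 0 <= d2 <= 1 -> 1 <= z ->
  `|low_part d1 z - low_part d2 z| <= L * z ^+ n * `|d1 - d2|.
Proof.
exists ((n.+1 * (n * n.+1`!) * 4 ^ n).+1%:R) => // d1 d2 z d1P d2P z1.
have z0 : 0 < z by rewrite (lt_le_trans ltr01).
rewrite /low_part -sumrB; apply: le_trans (ler_norm_sum _ _ _) _.
apply: (@le_trans _ _ (\sum_(k < n.+1)
    (n * n.+1`!)%:R * `|d1 - d2| * (4 ^+ n * z ^+ n))).
  apply: ler_sum => k _; rewrite -mulrBl normrM (ger0_norm (term_ge0 _ z1)).
  apply: ler_pM => //; first exact: term_ge0.
    apply: le_trans (low_ratio_lipschitz _ d1P d2P) _.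
    rewrite ler_wpM2r// ler_nat leq_mul ?leq_subr// leq_fact// ltnS leq_subr//.
  apply: le_trans (term_le z1 _) _; first by rewrite -ltnS.
  by rewrite ler_wpM2l ?exprn_ge0// ler_weXn2l// -ltnS.
rewrite sumr_const card_ord -[leLHS]mulr_natl.
rewrite [leLHS](_ : _ = (n.+1 * (n * n.+1`!) * 4 ^ n)%:R * (z ^+ n * `|d1 - d2|)).
  by rewrite -mulrA ler_wpM2r ?ler_nat// mulr_ge0 ?exprn_ge0// ltW.
by rewrite 3!natrM natrX; ring.
Qed.

Lemma low_part_bound : exists2 C : R, 0 < C & forall d z, 0 <= d -> 1 <= z ->
  `|low_part d z| <= C * z ^+ n.
Proof.
have [C C0 HC] := low_part_lead.
exists (C + 4 ^+ n); first by rewrite addr_gt0 ?exprn_gt0.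
move=> d z d0 z1.
have z0 : 0 < z by rewrite (lt_le_trans ltr01).
have zn : 0 <= z ^+ n by rewrite exprn_ge0// ltW.
have := HC d z d0 z1; have := term_le z1 (leqnn n); have := term_ge0 n z1.
move: (_ / _) => t t0 t1 H.
have : C / z * z ^+ n <= C * z ^+ n.
  by rewrite ler_wpM2r// ler_piMr ?invf_le1// ltW.
have := ler_normD (low_part d z - t) t; rewrite subrK (ger0_norm t0); lra.
Qed.

(** A zero with [d < 1] already has [d] of order [z ^- 2]: the first two terms of
    the tail outweigh [low_part] otherwise. *)
Lemma balance0_small : exists Z C : R, [/\ 1 <= Z, 0 < C & forall d z,
  Z <= z -> 0 <= d < 1 -> balance d z = 0 -> d <= C / z ^+ 2].
Proof.
have [C C0 HC] := low_part_bound.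
set F := C * m.+4`!%:R.
have f4 : 0 < m.+4`!%:R :> R by exact: fact_gt0R.
have F0 : 0 < F by rewrite mulr_gt0.
exists (1 + 2 * F), F; split => //.
  by rewrite lerDl mulr_ge0// ltW.
move=> d z zZ /andP[d0 d1] /eqP; rewrite subr_eq0 => /eqP E.
have z1 : 1 <= z by apply: le_trans zZ; rewrite lerDl mulr_ge0// ltW.
have z0 : 0 < z by rewrite (lt_le_trans ltr01).
have a0 : 0 <= 1 - d by rewrite subr_ge0 ltW.
have zn : 0 < z ^+ n by rewrite exprn_gt0.
have n4 : 1 <= 4 ^+ n :> R by rewrite exprn_ege1// ler1n.
have Kle : d * (4 * z) * kummer m.+2 (1 - d) z <= C.
  rewrite -(ler_pM2r zn); have := HC d z d0 z1.
  move=> /(le_trans (ler_norm _)); rewrite -E; apply: le_trans.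
  rewrite [in leRHS]exprS [(4 * z) ^+ n]exprMn.
  set K := kummer _ _ _.
  have K0 : 0 <= d * (4 * z) * K * z ^+ n.
    by rewrite !mulr_ge0 ?(ltW z0) ?(ltW zn)// ltW// kummer_gt0// ltW.
  rewrite [leRHS](_ : _ = 4 ^+ n * (d * (4 * z) * K * z ^+ n)); last by ring.
  by rewrite ler_peMl.
have K1 := kummer_ge_coef 0 m.+2 a0 (ltW z0).
have K2 := kummer_ge_coef 1 m.+2 a0 (ltW z0).
rewrite /kcoef poch0 !expr0 !mulr1 muln0 add0n mul1r in K1.
rewrite /kcoef pochS poch0 addr0 mul1r !expr1 muln1 add2n in K2.
move: (kummer _ _ _) K1 K2 Kle => K K1 K2 Kle.
have f24 : m.+2`!%:R <= m.+4`!%:R :> R by rewrite ler_nat leq_fact// ltnW.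
have f2 : 0 < m.+2`!%:R :> R by exact: fact_gt0R.
have dz0 : 0 <= d * (4 * z) by rewrite !mulr_ge0// ltW.
have dz : d * z <= F.
  have := le_trans (ler_wpM2l dz0 K1) Kle; rewrite ler_pdivrMr// => H.
  have := ler_wpM2l (ltW C0) f24; have : 0 <= d * z by rewrite mulr_ge0// ltW.
  rewrite /F; lra.
have dhalf : d <= 2^-1.
  have H := ler_wpM2l d0 zZ.
  rewrite -(ler_pM2r F0); lra.
rewrite ler_pdivlMr ?exprn_gt0//.
have := le_trans (ler_wpM2l dz0 K2) Kle.
rewrite [leLHS](_ : _ = d * z ^+ 2 * (16 * (1 - d)) / m.+4`!%:R); last by ring.
rewrite ler_pdivrMr//; apply: le_trans.
rewrite ler_peMr//; last by lra.
by rewrite mulr_ge0// exprn_ge0// ltW.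
Qed.

End eigenvalue_shift.

Section shift_asymptotics.
Variable R : realType.
Implicit Types (x z d : R) (i j k : nat).
Variables p n : nat.
Local Notation m := (2 * n + p)%N.
Local Notation balance := (@balance R p n).
Local Notation low_part := (@low_part R p n).

(** The Lipschitz constant, a series of one index less, is at most [4 * z] times the
    tail itself: the bound becomes relative, and [d] of order [z ^- 2] changes the
    tail by a relative amount of order [1 / z]. *)
Lemma tail_lipschitz : exists2 Z : R, 1 <= Z & forall d1 d2 z,
  Z <= z -> 0 <= d1 -> d1 <= d2 -> d2 <= 1 ->
  0 <= kummer m.+2 (1 - d1) z - kummer m.+2 (1 - d2) z
    <= 2 * z * (d2 - d1) * kummer m.+2 1 z.
Proof.
have [c c0 Hc] := kummer_step R m.+1.
exists (1 + 2 * c); first by rewrite lerDl mulr_ge0// ltW.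
move=> d1 d2 z zZ d10 d12 d21.
have z1 : 1 <= z by apply: le_trans zZ; rewrite lerDl mulr_ge0// ltW.
have z0 : 0 < z by rewrite (lt_le_trans ltr01).
have K0 : 0 < kummer m.+1 1 z by rewrite kummer_gt0// ltW.
have := kummer_lipschitz m.+1 (ltW z0) d10 d12 d21 => /andP[-> /=].
move=> /le_trans; apply.
have cz : c / z <= 2^-1 by rewrite ler_pdivrMr//; lra.
have := Hc z z0; have := ler_wpM2r (ltW K0) cz.
rewrite ler_norml => H1 /andP[H2 _].
have H3 : kummer m.+1 1 z <= 4 * z * kummer m.+2 1 z by lra.
have e0 : 0 <= (d2 - d1) / 2 by rewrite divr_ge0// subr_ge0.
apply: le_trans (ler_wpM2l e0 H3) _.
by rewrite le_eqVlt; apply/orP; left; apply/eqP; field.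
Qed.

Let tail_ge z : 0 <= z -> m.+2`!%:R^-1 <= kummer m.+2 (1 : R) z.
Proof.
move=> z0; apply: le_trans (kummer_ge_coef 0 _ ler01 z0).
by rewrite /kcoef poch0 !expr0 !mulr1 muln0 add0n mul1r.
Qed.

(** Two zeros are both so small that between them the first term of [balance] grows
    at a rate comparable with the tail, much faster than [low_part] can vary. *)
Lemma balance0_uniq : exists2 Z : R, 1 <= Z & forall d1 d2 z,
  Z <= z -> 0 <= d1 < 1 -> 0 <= d2 < 1 ->
  balance d1 z = 0 -> balance d2 z = 0 -> d1 = d2.
Proof.
have [Z1 [C [Z11 C0 Hsmall]]] := balance0_small R p n.
have [Z2 Z21 Htail] := tail_lipschitz.
have [L L0 Hlip] := low_part_lipschitz R p n.
have f2 : 0 < m.+2`!%:R :> R by exact: fact_gt0R.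
have F0 : 0 < L * m.+2`!%:R by rewrite mulr_gt0.
exists (Z1 + Z2 + 8 * C + 2 * (L * m.+2`!%:R)); first by lra.
move=> d1 d2 z zZ d1P d2P B1 B2.
wlog d12 : d1 d2 d1P d2P B1 B2 / d1 <= d2.
  by move=> W; case: (leP d1 d2) => [|/ltW] h; [|apply/esym]; exact: W.
have zZ1 : Z1 <= z by lra.
have zZ2 : Z2 <= z by lra.
have z1 : 1 <= z by lra.
have z0 : 0 < z by lra.
have small d : 0 <= d < 1 -> balance d z = 0 -> z * d <= 8^-1.
  move=> dP /(Hsmall _ _ zZ1 dP) H.
  have := ler_wpM2l (ltW z0) H.
  have -> : z * (C / z ^+ 2) = C / z by have := lt0r_neq0 z0 => zn; field.
  have : C / z <= 8^-1 by rewrite ler_pdivrMr//; lra.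
  lra.
have s1 := small _ d1P B1; have s2 := small _ d2P B2.
move: (d1P) (d2P) => /andP[d10 d11] /andP[d20 d21].
apply/eqP; rewrite eq_le d12 /= -subr_le0 leNgt; apply/negP => e0.
have [/andP[_ T2]] := (Htail 0 d2 z zZ2 (lexx _) d20 (ltW d21)).
rewrite !subr0 in T2.
have /andP[_ T12] := Htail d1 d2 z zZ2 d10 d12 (ltW d21).
move: B1 B2; rewrite /balance => /eqP; rewrite subr_eq0 => /eqP E1.
move=> /eqP; rewrite subr_eq0 => /eqP E2.
have d1I : 0 <= d1 <= 1 by rewrite d10 ltW.
have d2I : 0 <= d2 <= 1 by rewrite d20 ltW.
have := Hlip d2 d1 z d2I d1I z1; rewrite (ger0_norm (ltW e0)).
move=> /(le_trans (ler_norm _)); rewrite -E1 -E2.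
have := tail_ge (ltW z0).
move: (kummer m.+2 1 z) (kummer m.+2 (1 - d1) z) (kummer m.+2 (1 - d2) z) T2 T12 {E1 E2}
  => T T1' T2' T2 T12 Tge H.
set e := d2 - d1 in e0 T12 H.
have T0 : 0 < T by apply: lt_le_trans Tge; rewrite invr_gt0.
have eT : 0 < e * T by rewrite mulr_gt0.
have H1 : e * T / 2 <= d2 * T2' - d1 * T1'.
  have := ler_wpM2l (ltW e0) T2; have := ler_wpM2l d10 T12.
  have := ler_wpM2r (ltW eT) s1; have := ler_wpM2r (ltW eT) s2.
  rewrite /e; lra.
have zn : 0 < z ^+ n by rewrite exprn_gt0.
have P4 : z * z ^+ n <= (4 * z) ^+ n.+1.
  by rewrite exprMn -exprS ler_peMl ?exprn_ge0 ?(ltW z0)// exprn_ege1// ler1n.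
have H2 : z * z ^+ n * (e * T / 2) <= L * z ^+ n * e.
  apply: le_trans H; rewrite [leRHS](_ : _ = (4 * z) ^+ n.+1 *
    (d2 * T2' - d1 * T1')); last by ring.
  by apply: ler_pM => //; rewrite ?mulr_ge0 ?divr_ge0 // ltW.
have H3 : z * T <= 2 * L.
  have en : 0 < z ^+ n * e by rewrite mulr_gt0.
  by rewrite -(ler_pM2r en); lra.
have : z / m.+2`!%:R <= 2 * L by apply: le_trans H3; rewrite ler_wpM2l// ltW.
by rewrite ler_pdivrMr//; lra.
Qed.

Lemma balance_within_cts z : 1 <= z ->
  {within `[0, 2^-1], continuous (fun d => balance d z)}.
Proof.
move=> z1; have z0 : 0 <= z by apply: le_trans z1.
have I1 d : 0 <= d <= 2^-1 -> 0 <= d <= 1.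
  move=> /andP[-> /le_trans /=]; apply; rewrite invf_le1// ler1n//.
have cK : {within `[0, 2^-1], continuous (fun d => kummer m.+2 (1 - d) z)}.
  apply: (@lipschitz_within_cts _ _ _ _ (kummer m.+1 1 z / 2)) => d1 d2.
  wlog d12 : d1 d2 / d1 <= d2.
    move=> W d1P d2P; case: (leP d1 d2) => [h|/ltW h]; first exact: W.
    by rewrite distrC [`|d1 - d2|]distrC; exact: W.
  move=> /I1/andP[d10 _] /I1/andP[_ d21].
  have /andP[h1 h2] := kummer_lipschitz m.+1 z0 d10 d12 d21.
  rewrite ger0_norm// [`|_|]ler0_norm ?subr_le0// opprB.
  by apply: le_trans h2 _; rewrite mulrC mulrA mulrAC.
have [L _ Hlip] := low_part_lipschitz R p n.
have cH : {within `[0, 2^-1], continuous (fun d => low_part d z)}.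
  apply: (@lipschitz_within_cts _ _ _ _ (L * z ^+ n)) => d1 d2 /I1 ? /I1 ?.
  exact: Hlip.
have cI : {within `[0, 2^-1], continuous (fun d => d * (4 * z) ^+ n.+1 : R)}.
  by apply: continuous_subspaceT => d; apply: cvgM; [exact: cvg_id|exact: cvg_cst].
move=> d; rewrite /balance; apply: cvgB; last exact: cH.
by apply: cvgM; [exact: cI|exact: cK].
Qed.

(** At [d = 0] only [low_part] is left, with the sign of its leading term; at
    [d = 2^-1] the tail has won, its degree being higher. *)
Lemma balance0_exists : exists2 Z : R, 1 <= Z & forall z, Z <= z ->
  exists2 d, 0 < d < 1 & balance d z = 0.
Proof.
have [Z1 [C [Z11 C0 Hsmall]]] := balance0_small R p n.
have [C2 C20 Hlead] := low_part_lead R p n.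
have [C3 C30 Hb] := low_part_bound R p n.
have f2 : 0 < m.+2`!%:R :> R by exact: fact_gt0R.
have f0 : 0 < m`!%:R :> R by exact: fact_gt0R.
have F0 : 0 < C2 * m`!%:R by rewrite mulr_gt0.
have F2 : 0 < C3 * m.+2`!%:R by rewrite mulr_gt0.
exists (1 + 2 * (C2 * m`!%:R) + 2 * (C3 * m.+2`!%:R)); first by lra.
move=> z zZ; have z1 : 1 <= z by lra.
have z0 : 0 < z by lra.
have zn : 0 < z ^+ n by rewrite exprn_gt0.
have n4 : 1 <= 4 ^+ n :> R by rewrite exprn_ege1// ler1n.
have B0 : balance 0 z < 0.
  rewrite /balance !mul0r sub0r oppr_lt0.
  have := Hlead 0 z (lexx _) z1; rewrite ler_norml => /andP[H _].
  suff : C2 / z * z ^+ n < (4 * z) ^+ n / m`!%:R by lra.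
  rewrite exprMn [ltRHS]mulrAC ltr_pM2r// ltr_pdivrMr//.
  by rewrite mulrAC ltr_pdivlMr//; have := ler_wpM2r (ltW z0) n4; lra.
have B1 : 0 < balance 2^-1 z.
  rewrite /balance subr_gt0.
  have h0 : 0 <= (2^-1 : R) by [].
  apply: le_lt_trans (ler_norm _) _; apply: le_lt_trans (Hb _ _ h0 z1) _.
  have a0 : 0 <= 1 - 2^-1 :> R by lra.
  have := kummer_ge_coef 0 m.+2 a0 (ltW z0).
  rewrite /kcoef poch0 !expr0 !mulr1 muln0 add0n mul1r => H.
  have P4 : z * z ^+ n <= (4 * z) ^+ n.+1.
    by rewrite exprMn -exprS ler_peMl ?exprn_ge0 ?(ltW z0)// exprn_ege1// ler1n.
  apply: (@lt_le_trans _ _ (2^-1 * (z * z ^+ n) * m.+2`!%:R^-1)); last first.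
    by apply: ler_pM => //; rewrite ?invr_ge0 ?mulr_ge0 ?(ltW z0) ?(ltW zn)//;
      rewrite ler_wpM2l.
  rewrite ltr_pdivlMr//.
  have : C3 * m.+2`!%:R < 2^-1 * z by lra.
  by rewrite -(ltr_pM2r zn); lra.
have h0 : 0 <= (2^-1 : R) by [].
have mm : Num.min (balance 0 z) (balance 2^-1 z) <= 0
    <= Num.max (balance 0 z) (balance 2^-1 z).
  by rewrite minElt maxElt (lt_trans B0 B1) !ltW.
have [d] := IVT h0 (balance_within_cts z1) mm.
rewrite in_itv /= => /andP[d0 d1] E; exists d => //.
rewrite (le_lt_trans d1) ?andbT ?invf_lt1 ?ltr1n//.
rewrite lt_neqAle d0 andbT; apply/eqP => dE; move: B0.
by rewrite -dE in E; rewrite E ltxx.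
Qed.

End shift_asymptotics.

Section shift_rate.
Variable R : realType.
Implicit Types (x z d : R).
Variables p n : nat.
Local Notation m := (2 * n + p)%N.
Local Notation balance := (@balance R p n).

(** At a zero [d * (4 * z) * kummer m.+2 (1 - d) z] is [1 / m`!] up to a relative
    error of order [1 / z]. As [d] is of order [z ^- 2], the parameter may be moved
    to [1] at the same cost, where the growth of the series is known. *)
Lemma balance0_asymp : exists Z C : R, [/\ 1 <= Z, 0 < C & forall d x,
  0 < x -> Z <= x ^+ 2 -> 0 <= d < 1 -> balance d (x ^+ 2) = 0 ->
  `|d * (m`!%:R * Num.sqrt pi * expR (x ^+ 2) / (2 ^+ m * x ^+ (2 * m + 1))) - 1|
    <= C / x ^+ 2].
Proof.
have [Z1 [C1 [Z11 C10 Hsmall]]] := balance0_small R p n.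
have [Z2 Z21 Htail] := tail_lipschitz R p n.
have [C2 C20 Hlead] := low_part_lead R p n.
have [C3 C30 Has] := kummer1_asymp R m.+1.
have [s [s0 sE]] : exists s : R, 0 < s /\ Num.sqrt pi = s * 2.
  exists (Num.sqrt pi / 2); rewrite divfK ?pnatr_eq0//; split=> //.
  by rewrite divr_gt0// sqrtr_gt0 pi_gt0.
have f0 : 0 < m`!%:R :> R by exact: fact_gt0R.
set C4 := C2 * m`!%:R.
have C40 : 0 < C4 by rewrite mulr_gt0.
set C5 := C4 + 8 * C1.
have C50 : 0 < C5 by rewrite /C5; lra.
set C6 := (C5 * s + C3) / (s / 2).
have C60 : 0 < C6.
  by apply: divr_gt0; [apply: addr_gt0 => //; exact: mulr_gt0|exact: divr_gt0].
have D0 : 0 < 2 * C3 / s by rewrite divr_gt0 ?mulr_gt0.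
exists (Z1 + Z2 + 4 * C1 + C4 + 2 * C3 / s), C6; split => //.
  by clearbody C4 C5 C6; lra.
move=> d x x0 zZ dP B.
have x1 : 1 <= x.
  by rewrite -(@ler_pXn2r _ 2) ?nnegrE ?ltW// expr1n; lra.
have := Has x x1; rewrite sE mulfK ?pnatr_eq0//.
rewrite [x ^+ (2 * m + 1)]exprD [x ^+ (2 * m)]exprM expr1.
have zx : x ^+ 2 = x * x by rewrite expr2.
have z1 : 1 <= x ^+ 2 by lra.
have z0 : 0 < x ^+ 2 by lra.
have := Hlead d _ _ z1.
have zZ1 : Z1 <= x ^+ 2 by lra.
have zZ2 : Z2 <= x ^+ 2 by lra.
have := Hsmall d _ zZ1 dP B.
move: (dP) => /andP[d0 d1].
have := Htail 0 d _ zZ2 (lexx _) d0 (ltW d1); rewrite !subr0.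
move: B; rewrite /balance => /eqP; rewrite subr_eq0 => /eqP B.
move: (low_part p n d (x ^+ 2)) B => q B.
move: (x ^+ 2) zZ z1 z0 B {zx zZ1 zZ2} => z zZ z1 z0.
move: (kummer m.+2 1 z) (kummer m.+2 (1 - d) z) => T Td B.
move=> /andP[HT1 HT2] Hd /(_ d0) Hq HN.
have zn : 0 < z ^+ n by rewrite exprn_gt0.
(* both are [1] to leading order; the equation controls [v], the growth needs [u] *)
set u := d * (4 * z) * m`!%:R * T.
set v := d * (4 * z) * m`!%:R * Td.
have a0 : 0 <= d * (4 * z) * m`!%:R by rewrite !mulr_ge0// ltW.
have zd : 2 * z * d <= 2 * C1 / z.
  have := ler_wpM2l (ltW z0) Hd.
  have -> : z * (C1 / z ^+ 2) = C1 / z by have := lt0r_neq0 z0 => ?; field.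
  lra.
have zd2 : 2 * z * d <= 2^-1.
  by apply: le_trans zd _; rewrite ler_pdivrMr//; lra.
have Hv : `|v - 1| <= C4 / z.
  have P0 : 0 < (4 * z) ^+ n / m`!%:R by rewrite divr_gt0// exprn_gt0// mulr_gt0.
  have E : q - (4 * z) ^+ n / m`!%:R = (4 * z) ^+ n / m`!%:R * (v - 1).
    by rewrite -B exprS /v; have := lt0r_neq0 f0 => ?; field.
  move: Hq; rewrite E normrM (ger0_norm (ltW P0)) exprMn => Hq.
  have n4 : 1 <= 4 ^+ n :> R by rewrite exprn_ege1// ler1n.
  have : z ^+ n / m`!%:R * `|v - 1| <= C2 / z * z ^+ n.
    apply: le_trans Hq; rewrite ler_wpM2r// ler_wpM2r ?invr_ge0//.
    by rewrite ler_peMl// ltW.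
  move=> H; rewrite -(ler_pM2l (divr_gt0 zn f0)); apply: le_trans H _.
  rewrite /C4 le_eqVlt; apply/orP; left; apply/eqP.
  have f1 := lt0r_neq0 f0; have z2 := lt0r_neq0 z0.
  move: (m`!%:R) f1 => f f1.
  by field; rewrite f1 z2.
have uv : 0 <= u - v <= 2 * z * d * u.
  rewrite (_ : u - v = d * (4 * z) * m`!%:R * (T - Td)); last by rewrite /u /v; ring.
  rewrite mulr_ge0//=; apply: le_trans (ler_wpM2l a0 HT2) _.
  by rewrite /u le_eqVlt; apply/orP; left; apply/eqP; ring.
have Cz : C4 / z <= 1 by rewrite ler_pdivrMr//; lra.
have Hu : `|u - 1| <= C5 / z.
  move: uv Hv; rewrite ler_norml => /andP[uv1 uv2] /andP[v1 v2].
  have u4 : u <= 4.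
    case: (leP u 0) => [|u0]; first by lra.
    have := ler_wpM2r (ltW u0) zd2; lra.
  have u2 : 2 * z * d * u <= 8 * C1 / z.
    case: (leP u 0) => [u0|u0].
      apply: (@le_trans _ _ 0); first by rewrite mulr_ge0_le0 ?mulr_ge0 ?(ltW z0).
      by rewrite divr_ge0 ?mulr_ge0// ltW.
    have zd0 : 0 <= 2 * z * d by rewrite !mulr_ge0// ltW.
    apply: le_trans (ler_pM zd0 (ltW u0) zd u4) _.
    by rewrite le_eqVlt; apply/orP; left; apply/eqP; ring.
  rewrite ler_norml /C5; apply/andP; split; lra.
set N := T * (2 * z) ^+ m.+1 * x * expR (- z) in HN.
have HN2 : s / 2 <= N.
  have : C3 / z <= s / 2.
    have : 2 * C3 <= z * s.
      by rewrite -ler_pdivrMr//; move: (2 * C3 / s) D0 zZ => t t0 ?; lra.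
    rewrite ler_pdivrMr//; lra.
  move: HN; rewrite ler_norml => /andP[h1 h2]; lra.
have s20 : 0 < s / 2 by rewrite divr_gt0.
have N0 : 0 < N by apply: lt_le_trans HN2.
set w := d * _.
have wE : w = u * s / N.
  rewrite /w /u /N expRN exprS exprMn.
  have T0 : T != 0 by apply: contraTneq N0 => T0; rewrite /N T0 !mul0r ltxx.
  have eN : expR z != 0 by rewrite gt_eqF// expR_gt0.
  have zm : z ^+ m != 0 by rewrite gt_eqF// exprn_gt0.
  have tm : 2 ^+ m != 0 :> R by rewrite gt_eqF// exprn_gt0.
  have x0' := lt0r_neq0 x0; have z0' := lt0r_neq0 z0.
  move: (z ^+ m) (2 ^+ m) (expR z) eN zm tm => Z t e eN zm tm.
  by field; rewrite eN zm tm x0' z0' T0.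
rewrite wE (_ : u * s / N - 1 = ((u - 1) * s + (s - N)) / N); last first.
  by have := lt0r_neq0 N0; move: (N) => N' N'0; field.
rewrite normrM normfV (ger0_norm (ltW N0)) ler_pdivrMr//.
apply: (@le_trans _ _ ((C5 * s + C3) / z)).
  apply: le_trans (ler_normD _ _) _; rewrite normrM (ger0_norm (ltW s0)).
  have := ler_wpM2r (ltW s0) Hu; move: HN; rewrite distrC; lra.
rewrite /C6 [leRHS](_ : _ = (C5 * s + C3) / z * (N / (s / 2))); last by ring.
rewrite ler_peMr//; last by rewrite ler_pdivlMr// mul1r.
by rewrite divr_ge0 ?(ltW z0)// addr_ge0 ?(ltW C30)// mulr_ge0// ltW.
Qed.

End shift_rate.

Section kummer_zeros_and_growth.
Variable R : realType.
Implicit Types (a x z d : R).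

Lemma kummer_parameter_zero p n : exists Z C : R, [/\ 1 <= Z, 0 < C & forall x,
  0 < x -> Z <= x ^+ 2 -> exists d, [/\ 0 < d <= 4^-1,
    forall d', 0 <= d' < 1 -> kummer p (- n%:R - d') (x ^+ 2) = 0 <-> d' = d &
  `|d * ((2 * n + p)`!%:R * Num.sqrt pi * expR (x ^+ 2)
      / (2 ^+ (2 * n + p) * x ^+ (2 * (2 * n + p) + 1))) - 1| <= C / x ^+ 2]].
Proof.
have [Z1 [C1 [Z11 C10 Hsmall]]] := balance0_small R p n.
have [Z2 Z21 Huniq] := balance0_uniq R p n.
have [Z3 Z31 Hex] := balance0_exists R p n.
have [Z4 [C4 [Z41 C40 Has]]] := balance0_asymp R p n.
exists (Z1 + Z2 + Z3 + Z4 + 4 * C1), C4; split => //; first by lra.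
move=> x x0; have := Has _ x x0; move: (x ^+ 2) => z {}Has zZ.
have [d /andP[d0 d1] B] : exists2 d, 0 < d < 1 & balance p n d z = 0.
  by apply: Hex; lra.
have dI : 0 <= d < 1 by rewrite ltW.
exists d; split.
- rewrite d0 /=.
  have zZ1 : Z1 <= z by lra.
  have z1 : 1 <= z by lra.
  apply: le_trans (Hsmall d z zZ1 dI B) _.
  have z2 : z <= z ^+ 2 by rewrite expr2 ler_peMl// (le_trans ler01).
  by rewrite ler_pdivrMr ?exprn_gt0 ?(lt_le_trans ltr01)//; lra.
- move=> d' d'I; have := d'I => /andP[d'0 d'1]; rewrite kummer_eq0//.
  split => [B'|->//]; apply: (Huniq _ _ z) => //; lra.
- by apply: Has => //; lra.
Qed.

Lemma exp_beats_powers (A : R) k : 0 <= A ->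
  exists2 Z : R, 1 <= Z & forall z, Z <= z -> A * z ^+ k <= expR (z / 2).
Proof.
move=> A0; have f0 : 0 < k.+1`!%:R :> R by rewrite ltr0n fact_gt0.
exists (1 + A * 2 ^+ k.+1 * k.+1`!%:R).
  by rewrite lerDl !mulr_ge0 ?exprn_ge0.
move=> z zZ; have z0 : 0 < z.
  by apply: lt_le_trans zZ; rewrite ltr_wpDr// !mulr_ge0 ?exprn_ge0.
have y0 : 0 <= z / 2 by rewrite divr_ge0// ltW.
have := expR_ge1Dxn k y0; set E := expR _ => HE.
apply: (@le_trans _ _ ((z / 2) ^+ k.+1 / k.+1`!%:R)); last by lra.
rewrite expr_div_n exprSr ler_pdivlMr// ler_pdivlMr ?exprn_gt0//.
rewrite [leRHS]mulrC.
rewrite [leLHS](_ : _ = A * 2 ^+ k.+1 * k.+1`!%:R * z ^+ k); last by ring.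
by rewrite ler_wpM2r ?exprn_ge0 ?(ltW z0)//; lra.
Qed.

Lemma kummer_mono i a b z : 0 <= a -> a <= b -> 0 <= z ->
  kummer i a z <= kummer i b z.
Proof.
move=> a0 ab z0; apply: ler_psum => //; try exact: entire_kcoef.
move=> k; rewrite /kcoef !ler_wpM2r ?invr_ge0 ?exprn_ge0//.
elim: k => [|k IHk]; first by rewrite !poch0.
by rewrite !pochS ler_pM ?poch_ge0 ?addr_ge0// lerD2r.
Qed.

(** Unless the series terminates it grows like [exp z] up to powers of [z], since its
    tail is a series with parameter at least [1]; half of the exponent is enough to
    beat the Gaussian factor. *)
Lemma kummer_growth p a : (forall n : nat, a != - n%:R) ->
  exists2 X : R, 1 <= X & forall x, X <= x ->
    1 <= `|x ^+ p * kummer p a (x ^+ 2)| * expR (- (x ^+ 2 / 2)).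
Proof.
move=> aN.
(* beyond [N] all the factors of the Pochhammer symbol are at least [1] *)
pose N := (Num.truncn `|a|).+2.
have aN1 : 1 <= a + N%:R.
  have : `|a| < (Num.truncn `|a|).+1%:R by exact: truncnS_gt.
  rewrite /N -[in X in _ -> X](natr1 (Num.truncn `|a|).+1).
  by have := ler_norm (- a); rewrite normrN; lra.
have pN : poch a N != 0.
  by apply/prodf_neq0 => j _; rewrite addr_eq0 aN.
have [i iE] : exists i, (2 * N + p = i.+1)%N by exists (2 * N + p).-1; rewrite /N; lia.
have [C C0 HC] := kummer1_asymp R i.
set s := Num.sqrt pi / 2 in HC.
have s0 : 0 < s by rewrite divr_gt0// sqrtr_gt0 pi_gt0.
clearbody s.
set S := \sum_(k < N) `|kcoef p a k|.
have S0 : 0 <= S by rewrite sumr_ge0.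
set c := s / 2 * `|poch a N|.
have c0 : 0 < c by apply: mulr_gt0; [exact: divr_gt0|rewrite normr_gt0].
have [Z1 Z11 HZ1] := exp_beats_powers N S0.
have B0 : 0 <= 2 * 2 ^+ i / c.
  by apply: divr_ge0; [rewrite mulr_ge0 ?exprn_ge0|exact: ltW].
have [Z2 Z21 HZ2] := exp_beats_powers i.+1 B0.
have D0 : 0 <= 2 * C / s by rewrite divr_ge0 ?mulr_ge0// ltW.
exists (Z1 + Z2 + 2 * C / s); first by lra.
move=> x xX; have x1 : 1 <= x by lra.
have x0 : 0 < x by lra.
have xz : x <= x ^+ 2 by rewrite expr2 ler_peMl// ltW.
have := HC x x1.
rewrite normrM (ger0_norm (exprn_ge0 _ (ltW x0))).
have xp : 1 <= x ^+ p by rewrite exprn_ege1.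
have zZ : Z1 + Z2 + 2 * C / s <= x ^+ 2 by lra.
move: (x ^+ 2) zZ xz => z zZ xz {}HC.
have z1 : 1 <= z by lra.
have z0 : 0 < z by lra.
have zZ1 : Z1 <= z by lra.
have zZ2 : Z2 <= z by lra.
set E := expR (z / 2).
have E0 : 0 < E by exact: expR_gt0.
have EE : expR z = E * E by rewrite -expRD; congr expR; field.
rewrite expRN -/E ler_pdivlMr// mul1r.
suff: E <= `|kummer p a z|.
  by move=> /le_trans; apply; rewrite ler_peMl.
have K1 : s / 2 * (E * E) <= kummer i.+1 1 z * (2 ^+ i * z ^+ i.+1).
  have Cz : C / z <= s / 2.
    have : 2 * C <= z * s.
      by rewrite -ler_pdivrMr//; move: (2 * C / s) D0 zZ => t t0 ?; lra.
    by rewrite ler_pdivrMr//; lra.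
  set T := kummer _ _ _ in HC *.
  have T0 : 0 < T by rewrite kummer_gt0// ltW.
  have : s / 2 <= T * (2 * z) ^+ i * x * expR (- z).
    by move: HC; rewrite ler_norml => /andP[h1 h2]; lra.
  rewrite expRN EE ler_pdivlMr ?mulr_gt0// => /le_trans; apply.
  rewrite exprMn exprSr -!mulrA !ler_wpM2l ?exprn_ge0 ?(ltW z0) ?(ltW T0)//.
have K2 : `|poch a N| * kummer i.+1 1 z <=
    `|poch a N * (4 * z) ^+ N * kummer i.+1 (a + N%:R) z|.
  rewrite 2!normrM -mulrA ler_wpM2l//.
  have := kummer_mono i.+1 ler01 aN1 (ltW z0).
  have : 0 < kummer i.+1 1 z by rewrite kummer_gt0// ltW.
  move: (kummer i.+1 1 z) (kummer i.+1 (a + N%:R) z) => u v u0 uv.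
  have v0 : 0 <= v by apply: le_trans uv; exact: ltW.
  rewrite (ger0_norm v0); apply: le_trans uv _; rewrite ler_peMl//.
  have z4 : 1 <= 4 * z by lra.
  by apply: le_trans (ler_norm _); exact: exprn_ege1.
have K3 : `|\sum_(k < N) kcoef p a k * z ^+ k| <= E.
  apply: le_trans (HZ1 z zZ1); apply: le_trans (ler_norm_sum _ _ _) _.
  rewrite /S mulr_suml; apply: ler_sum => k _.
  rewrite normrM (ger0_norm (exprn_ge0 _ (ltW z0))) ler_wpM2l//.
  by rewrite ler_weXn2l// ltnW.
have K4 : 2 * E <= `|poch a N| * kummer i.+1 1 z.
  have zi : 0 < 2 ^+ i * z ^+ i.+1 by rewrite mulr_gt0 ?exprn_gt0.
  rewrite -(ler_pM2r zi).
  have := HZ2 z zZ2; rewrite -/E mulrAC ler_pdivrMr// => H.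
  have H2 := ler_wpM2r (ltW E0) H.
  have H3 := ler_wpM2l (normr_ge0 (poch a N)) K1.
  rewrite /c in H2; lra.
rewrite (kummer_split N) iE.
move: (\sum_(k < N) _) (poch a N * _ * _) K2 K3 => u v K2 K3.
by have := lerB_normD v u; rewrite [v + u]addrC; lra.
Qed.

End kummer_zeros_and_growth.

(** * Solutions of the oscillator equation *)

Section oscillator.
Variable R : realType.
Implicit Types (a mu s x y : R) (b : bool).

(** The solution of given parity of [y'' = 2 x y' + 2 (2 a - b) y], Hermite's
    equation. *)
Definition hermite b a y : R := y ^+ b * kummer b a (y ^+ 2).

Lemma is_derive_hermite1 a y :
  is_derive y (1 : R) (hermite true a) (hermite false a y).
Proof.
have dk := is_derive_kummer_sqr 1 a y.
rewrite /hermite expr0 mul1r /=.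
have -> : (fun y => y ^+ true * kummer true a (y ^+ 2)) =
  (fun y => y * kummer 1 a (y ^+ 2)) by apply/funext => t; rewrite expr1.
apply: is_derive_eq; rewrite /GRing.scale /= mulr1.
by rewrite -kummer1_derive; ring.
Qed.

Lemma is_derive_hermite0 a y : is_derive y (1 : R) (hermite false a)
  (2 * y * hermite false a y + (4 * a - 2) * hermite true a y).
Proof.
have dk := is_derive_kummer_sqr 0 a y.
rewrite /hermite expr0 mul1r expr1 /=.
have -> : (fun y => y ^+ false * kummer false a (y ^+ 2)) =
  (fun y => kummer 0 a (y ^+ 2)) by apply/funext => t; rewrite mul1r.
apply: is_derive_eq.
transitivity (y * (2 * psum (pseries_diffs (kcoef 0 a)) (y ^+ 2))); first by ring.
by rewrite kummer0_derive; ring.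
Qed.

Definition osc_param b mu : R := (2 * b%:R + 1 - mu) / 4.

(** [s] is [h ^ (- 1/2)] and [mu] the spectral parameter in units of [h]. *)
Definition osc b mu s x : R :=
  expR (- ((s * x) ^+ 2 / 2)) * hermite b (osc_param b mu) (s * x).

(** The derivative of [osc], with the derivative of [hermite] already eliminated. *)
Definition dosc b mu s x : R :=
  s * (expR (- ((s * x) ^+ 2 / 2)) *
    if b then hermite false (osc_param b mu) (s * x)
                - (s * x) * hermite true (osc_param b mu) (s * x)
    else (s * x) * hermite false (osc_param b mu) (s * x)
           - (1 + mu) * hermite true (osc_param b mu) (s * x)).

Let is_derive_scale (f : R -> R) df s x : is_derive (s * x) (1 : R) f df ->
  is_derive x (1 : R) (fun x => f (s * x)) (s * df).
Proof.
move=> D; have -> : (fun x => f (s * x)) = f \o ( *%R s) by [].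
have dl : is_derive x (1 : R) ( *%R s) s.
  have -> : *%R s = (fun x => s * x) by [].
  by apply: is_derive_eq; rewrite /GRing.scale /=; ring.
by rewrite mulrC; exact: is_derive1_comp.
Qed.

Let is_derive_gauss y : is_derive y (1 : R) (fun y => expR (- (y ^+ 2 / 2)))
  (- y * expR (- (y ^+ 2 / 2))).
Proof.
have -> : (fun y => expR (- (y ^+ 2 / 2))) = expR \o (fun y : R => - (y ^+ 2 / 2)).
  by [].
have d2 : is_derive y (1 : R) (fun y => - (y ^+ 2 / 2)) (- y).
  by apply: is_derive_eq; rewrite /GRing.scale /=; field.
by rewrite mulrC; exact: is_derive1_comp.
Qed.

Lemma is_derive_osc b mu s x : is_derive x (1 : R) (osc b mu s) (dosc b mu s x).
Proof.
apply: (@is_derive_scale (fun y => expR (- (y ^+ 2 / 2)) * hermite b (osc_param b mu) y)).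
move: (s * x) => y; have dg := is_derive_gauss y.
case: b; [have dh := is_derive_hermite1 (osc_param true mu) y
         |have dh := is_derive_hermite0 (osc_param false mu) y];
  apply: is_derive_eq; rewrite /GRing.scale /=; first by ring.
have -> : 4 * osc_param false mu - 2 = - (1 + mu) by rewrite /osc_param /=; field.
by ring.
Qed.

Lemma is_derive_dosc b mu s x :
  is_derive x (1 : R) (dosc b mu s) (s ^+ 2 * ((s * x) ^+ 2 - mu) * osc b mu s x).
Proof.
rewrite [X in is_derive _ _ _ X](_ : _ =
  s * (s * (((s * x) ^+ 2 - mu) * osc b mu s x))); last by ring.
apply: (@is_derive_scale (fun y => s * (expR (- (y ^+ 2 / 2)) *
    if b then hermite false (osc_param b mu) y - y * hermite true (osc_param b mu) y
    else y * hermite false (osc_param b mu) y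
         - (1 + mu) * hermite true (osc_param b mu) y))).
rewrite /osc; move: (s * x) => y; have dg := is_derive_gauss y.
have dh1 := is_derive_hermite1 (osc_param b mu) y.
have dh0 := is_derive_hermite0 (osc_param b mu) y.
case: b dh1 dh0 => dh1 dh0; apply: is_derive_eq; rewrite /GRing.scale /= !mulr1.
  have -> : 4 * osc_param true mu - 2 = 1 - mu by rewrite /osc_param /=; field.
  by ring.
have -> : 4 * osc_param false mu - 2 = - (1 + mu) by rewrite /osc_param /=; field.
by ring.
Qed.

Lemma oscN b mu s x : osc b mu s (- x) = (-1) ^+ b * osc b mu s x.
Proof.
rewrite /osc /hermite mulrN sqrrN.
by case: b => /=; rewrite ?expr1 ?expr0; ring.
Qed.

Let kummer_at0 i a : kummer i a 0 = (i`!%:R)^-1.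
Proof.
rewrite /kummer psum_shift; last exact: entire_kcoef.
by rewrite mul0r addr0 /kcoef poch0 expr0 muln0 !mul1r.
Qed.

Lemma osc_at0 b mu s : osc b mu s 0 = (~~ b)%:R.
Proof.
rewrite /osc /hermite mulr0 expr0n /= mul0r oppr0 expR0 mul1r kummer_at0.
by case: b; rewrite /= ?expr1 ?mul0r// expr0 fact0 invr1 mulr1.
Qed.

Lemma dosc_at0 b mu s : dosc b mu s 0 = s * b%:R.
Proof.
rewrite /dosc /hermite mulr0 expr0n /= mul0r oppr0 expR0 mul1r !kummer_at0.
by case: b; rewrite /= ?expr1 ?expr0 ?fact0 ?invr1; ring.
Qed.

(** The Wronskian of two solutions is constant, so that any solution is read off
    from its value and its derivative at the origin. *)
Lemma osc_span (I : set R) (f g : R -> R) mu s : s != 0 -> I 0 ->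
  (forall x t, I x -> `|t| <= `|x| -> 0 <= t * x -> I t) ->
  (forall x, I x -> is_derive x (1 : R) f (g x)) ->
  (forall x, I x -> is_derive x (1 : R) g (s ^+ 2 * ((s * x) ^+ 2 - mu) * f x)) ->
  forall x, I x -> f x = f 0 * osc false mu s x + g 0 / s * osc true mu s x.
Proof.
move=> s0 I0 Istar df dg x Ix.
have cst (F : R -> R) : (forall t, I t -> is_derive t (1 : R) F 0) -> F x = F 0.
  move=> dF; case: (leP 0 x) => x0.
    apply/esym/is_derive0_cst => // t /andP[t0 tx]; apply: dF.
    by apply: (Istar x) => //; rewrite ?mulr_ge0// !ger0_norm.
  apply: is_derive0_cst => [|t /andP[t0 tx]]; first exact: ltW.
  apply: dF; apply: (Istar x) => //; last by rewrite mulr_le0// ltW.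
  by rewrite !ler0_norm ?lerN2// ltW.
have W b : f x * dosc b mu s x - g x * osc b mu s x
    = f 0 * dosc b mu s 0 - g 0 * osc b mu s 0.
  apply: (cst (fun x => f x * dosc b mu s x - g x * osc b mu s x)) => t It.
  have h1 := df t It; have h2 := dg t It.
  have h3 := is_derive_osc b mu s t; have h4 := is_derive_dosc b mu s t.
  by apply: is_derive_eq; rewrite /GRing.scale /=; ring.
have W0 : osc false mu s x * dosc true mu s x - dosc false mu s x * osc true mu s x = s.
  transitivity (osc false mu s 0 * dosc true mu s 0
                - dosc false mu s 0 * osc true mu s 0); last first.
    by rewrite !osc_at0 !dosc_at0 /=; ring.
  apply: (cst (fun x => osc false mu s x * dosc true mu s x
                        - dosc false mu s x * osc true mu s x)) => t _.
  have h1 := is_derive_osc false mu s t; have h2 := is_derive_dosc false mu s t.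
  have h3 := is_derive_osc true mu s t; have h4 := is_derive_dosc true mu s t.
  by apply: is_derive_eq; rewrite /GRing.scale /=; ring.
have W1 : f x * dosc true mu s x - g x * osc true mu s x = f 0 * s.
  by rewrite W osc_at0 dosc_at0 /=; ring.
have W2 : f x * dosc false mu s x - g x * osc false mu s x = - g 0.
  by rewrite W osc_at0 dosc_at0 /=; ring.
apply: (mulfI s0); rewrite [RHS](_ : _ =
  f 0 * s * osc false mu s x - (- g 0) * osc true mu s x); last by field.
by rewrite -W1 -W2 -[in LHS]W0; ring.
Qed.

End oscillator.

(** * From weak eigenvectors to classical solutions *)

Section weak_to_classical.
Variable R : realType.
Implicit Types (f g q k F G : R -> R) (Om : set R) (a b c d x y : R).
Local Notation mu := (@lebesgue_measure R).

(** The two conditions of a weak derivative, up to the constant [c] that the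
    imaginary unit turns into [1] or [- 1] on real and imaginary parts. *)
Let primitive Om c F G := forall x y, x <= y -> `[x, y] `<=` Om ->
  mu.-integrable `[x, y] (EFin \o G) /\ F y - F x = c * \int[mu]_(t in `[x, y]) G t.

Let open_segment Om x : open Om -> Om x -> exists a b,
  [/\ a < x, x < b & `[a, b] `<=` Om].
Proof.
move=> oOm Omx; have /nbhs_ballP[e /= e0 xe] : nbhs x Om by exact: open_nbhs_nbhs.
exists (x - e / 2), (x + e / 2); split.
- by rewrite ltrBlDr ltrDl divr_gt0.
- by rewrite ltrDl divr_gt0.
- move=> t; rewrite /= in_itv /= => /andP[t1 t2]; apply: xe.
  by rewrite /ball /= ltr_norml; apply/andP; split; lra.
Qed.

Let primitive_near Om c F G x : open Om -> primitive Om c F G -> Om x ->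
  exists a b, [/\ a < x, x < b, `[a, b] `<=` Om,
    mu.-integrable `[a, b] (EFin \o G) &
    \forall t \near x, F a + c * \int[mu]_(s in `[a, t]) G s = F t].
Proof.
move=> oOm P Omx; have [a [b [ax xb abOm]]] := open_segment oOm Omx.
exists a, b; split => //; first by have [] := P a b (ltW (lt_trans ax xb)) abOm.
near=> t.
have ta : a < t by near: t; exact: lt_nbhsr.
have tb : t < b by near: t; exact: lt_nbhsl.
have [|_ <-] := P a t (ltW ta); last by rewrite addrC subrK.
apply: subset_trans abOm => s /=; rewrite !in_itv /= => /andP[-> /le_trans].
by apply; exact: ltW.
Unshelve. all: by end_near. Qed.

Let primitive_cts Om c F G x : open Om -> primitive Om c F G -> Om x ->
  {for x, continuous F}.
Proof.
move=> oOm P Omx; have [a [b [ax xb _ iG nF]]] := primitive_near oOm P Omx.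
have ab := lt_trans ax xb.
have := parameterized_integral_continuous (ltW ab) iG.
move=> /(continuous_within_itvP _ ab)[/(_ x)].
rewrite in_itv /= ax xb => /(_ isT) cI _ _.
have cF : (fun t => F a + c * \int[mu]_(s in `[a, t]) G s) @ x -->
    F a + c * \int[mu]_(s in `[a, x]) G s.
  by apply: cvgD; [exact: cvg_cst|apply: cvgM; [exact: cvg_cst|exact: cI]].
rewrite /prop_for /continuous_at -[X in _ --> X](nbhs_singleton nF).
by apply: cvg_trans cF; exact: near_eq_cvg nF.
Qed.

Let primitive_derive Om c F G x : open Om -> primitive Om c F G -> Om x ->
  {for x, continuous G} -> is_derive x (1 : R) F (c * G x).
Proof.
move=> oOm P Omx cG; have [a [b [ax xb _ iG nF]]] := primitive_near oOm P Omx.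
have [dI I'] := continuous_FTC1_closed xb iG ax cG.
have D : is_derive x (1 : R) (fun t => \int[mu]_(s in `[a, t]) G s) (G x).
  by split => //; rewrite -derive1E.
apply: near_eq_is_derive nF _.
by apply: is_derive_eq; rewrite /GRing.scale /=; ring.
Qed.

(** A primitive is continuous and has a derivative wherever the integrand is
    continuous. So [f] and [g] are continuous, [q] may be replaced by the continuous
    [k * f], and both derivatives exist everywhere. *)
Lemma weak_ode Om f g q k c d : open Om -> primitive Om c f g ->
  primitive Om d g q -> {ae mu, forall x, Om x -> q x = k x * f x} ->
  continuous k ->
  forall x, Om x -> is_derive x (1 : R) f (c * g x) /\
                    is_derive x (1 : R) g (d * (k x * f x)).
Proof.
move=> oOm Pf Pg qE ck x Omx; split.
  exact: (primitive_derive oOm Pf Omx (primitive_cts oOm Pg Omx)).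
have cr t : Om t -> {for t, continuous (fun t => k t * f t)}.
  by move=> Omt; apply: cvgM; [exact: ck|exact: primitive_cts oOm Pf Omt].
suff Pr : primitive Om d g (fun t => k t * f t).
  exact: (primitive_derive oOm Pr Omx (cr x Omx)).
move=> a b ab abOm; have [iq gE] := Pg a b ab abOm.
have ir : mu.-integrable `[a, b] (EFin \o (fun t => k t * f t)).
  apply: continuous_segment_integrable.
  by apply: continuous_in_subspaceT => t /set_mem /abOm; exact: cr.
split => //; rewrite gE; congr (_ * _); rewrite /Rintegral; congr fine.
apply: ae_eq_integral => //.
- exact: measurable_int iq.
- exact: measurable_int ir.
- move: qE; apply: filterS; first exact: (ae_filter_ringOfSetsType mu).
  by move=> t H /abOm /H /= ->.
Qed.

End weak_to_classical.

(** * Square integrability *)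

Section square_integrable.
Variable R : realType.
Implicit Types (f : R -> R) (x : R) (Om : set R).
Local Notation mu := (@lebesgue_measure R).

Lemma ae0_continuous_eq0 f Om : open Om -> (forall x, {for x, continuous f}) ->
  {ae mu, forall x, Om x -> f x = 0} -> forall x, Om x -> f x = 0.
Proof.
move=> oOm cf [N [mN N0 fN]] x Omx; apply/eqP/negPn/negP => fx.
have /nbhs_ballP[e /= e0 xe] : \forall t \near x, Om t /\ f t != 0.
  near=> t; split; near: t; first exact: open_nbhs_nbhs.
  exact: (cvgr_neq0 _ (cf x)).
have sub : ball x e `<=` N.
  by move=> t /xe [Omt ft]; apply: fN => /= /(_ Omt)/eqP; rewrite (negbTE ft).
have : (mu (ball x e) <= mu N)%E.
  by apply: le_measure; rewrite ?inE// ball_itv; exact: measurable_itv.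
rewrite N0 lebesgue_measure_ball ?(ltW e0)// lee_fin leNgt => /negP; apply.
by rewrite mulrn_wgt0.
Unshelve. all: by end_near. Qed.

Lemma Lfun2P f : measurable_fun setT f ->
  (\int[mu]_x (f x ^+ 2)%:E < +oo)%E -> f \in Lfun mu 2%:E.
Proof.
move=> mf If; rewrite inE; apply/andP; split; rewrite inE//=.
rewrite /finite_norm unlock /=; apply: poweR_lty; apply: le_lt_trans If.
rewrite le_eqVlt; apply/orP; left; apply/eqP; apply: eq_integral => x _.
by rewrite /= powR_mulrn// real_normK// num_real.
Qed.

Lemma Lfun2_lty f : f \in Lfun mu 2%:E -> (\int[mu]_x (f x ^+ 2)%:E < +oo)%E.
Proof.
move=> /Lfun2_integrable_sqr/integrableP[_]; apply: le_lt_trans.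
rewrite le_eqVlt; apply/orP; left; apply/eqP; apply: eq_integral => x _.
by rewrite /= ger0_norm// sqr_ge0.
Qed.

Lemma continuous_Lfun2_itv f a : continuous f -> f \_ `]- a, a[ \in Lfun mu 2%:E.
Proof.
move=> cf; apply: Lfun2P.
  apply/(measurable_restrict f) => //.
  by apply: measurable_funTS; exact: continuous_measurable_fun.
rewrite [ltLHS](_ : _ = \int[mu]_(x in `](- a)%R, a[) (f x ^+ 2)%:E)%E; last first.
  rewrite [RHS]integral_mkcond; apply: eq_integral => x _.
  by rewrite !patchE; case: ifP => _ //; rewrite expr0n.
have c2 : continuous (fun x => f x ^+ 2) by move=> x; apply: cvgM; exact: cf.
have /integrableP[_] : mu.-integrable `[- a, a] (EFin \o (fun x => f x ^+ 2)).
  by apply: continuous_segment_integrable; exact: continuous_subspaceT.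
apply: le_lt_trans.
apply: (@le_trans _ _ (\int[mu]_(x in `[(- a)%R, a]) (f x ^+ 2)%:E)%E).
  apply: ge0_subset_integral => //.
  - apply/measurable_EFinP; apply: measurable_funTS.
    exact: continuous_measurable_fun.
  - by move=> x _; rewrite lee_fin sqr_ge0.
  - exact: subset_itv_oo_cc.
rewrite le_eqVlt; apply/orP; left; apply/eqP; apply: eq_integral => x _.
by rewrite /= ger0_norm// sqr_ge0.
Qed.

Lemma gauss_dominated_Lfun2 f (C s : R) : 0 < s -> continuous f ->
  (forall x, f x ^+ 2 <= C * expR (- ((s * x) ^+ 2 / 2))) -> f \in Lfun mu 2%:E.
Proof.
move=> s0 cf fC; apply: Lfun2P; first exact: continuous_measurable_fun.
have sV0 : s^-1 != 0 by rewrite invr_eq0 gt_eqF.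
have E x : C * expR (- ((s * x) ^+ 2 / 2))
    = C / normal_peak s^-1 * normal_pdf 0 s^-1 x.
  rewrite normal_pdfE// mulrA divfK ?gt_eqF ?normal_peak_gt0//; congr (_ * expR _).
  by rewrite subr0 -mulr_natr; have := lt0r_neq0 s0 => ?; field.
have := integrable_normal_pdf (0 : R) s^-1.
move=> /(integrableZl measurableT (C / normal_peak s^-1)) iN.
have /integrableP[mN] := iN; apply: le_lt_trans.
have c2 : continuous (fun x => f x ^+ 2) by move=> x; apply: cvgM; exact: cf.
apply: ge0_le_integral => //.
- by move=> x _; rewrite lee_fin sqr_ge0.
- by apply/measurable_EFinP; exact: continuous_measurable_fun.
- exact: measurableT_comp.
- move=> x _ /=; rewrite lee_fin; apply: le_trans (fC x) _.
  by rewrite E; exact: ler_norm.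
Qed.

(** Both halves of the line are used: where one of the two parities cancels the
    other on the right, they add up on the left. *)
Lemma parity_not_Lfun2 f (g0 g1 : R -> R) (X c : R) : continuous f ->
  (forall x, f x = g0 x + g1 x) -> (forall x, f (- x) = g0 x - g1 x) ->
  (forall x, X <= x -> c <= g0 x ^+ 2 + g1 x ^+ 2) -> 0 < c ->
  f \notin Lfun mu 2%:E.
Proof.
move=> cf fE fNE gc c0; apply/negP => /Lfun2_lty If.
have {}gc x : `|X| <= x -> c <= g0 x ^+ 2 + g1 x ^+ 2.
  by move=> Xx; apply: gc; apply: le_trans (ler_norm _) Xx.
have := normr_ge0 X; move: `|X| gc => {}X gc X0.
have c2 : continuous (fun x => f x ^+ 2) by move=> x; apply: cvgM; exact: cf.
have cN : continuous (fun x => f (- x) ^+ 2).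
  move=> x; apply: (@continuous_comp _ _ _ -%R (fun x => f x ^+ 2)); last exact: c2.
  exact: opp_continuous.
have m2 D : measurable_fun D (fun x => (f x ^+ 2)%:E).
  by apply/measurable_EFinP; apply: measurable_funTS; exact: continuous_measurable_fun.
have mN D : measurable_fun D (fun x => (f (- x) ^+ 2)%:E).
  by apply/measurable_EFinP; apply: measurable_funTS; exact: continuous_measurable_fun.
have H1 : (\int[mu]_(x in `[X, +oo[) (f x ^+ 2)%:E < +oo)%E.
  apply: le_lt_trans If; apply: ge0_subset_integral => //; first exact: m2.
  by move=> x _; rewrite lee_fin sqr_ge0.
have H2 : (\int[mu]_(x in `[X, +oo[) (f (- x) ^+ 2)%:E < +oo)%E.
  have cW : {within `]-oo, - X], continuous (fun x => f x ^+ 2)}.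
    exact: continuous_subspaceT.
  have W0 : {in `]-oo, - X[, forall x, 0 <= f x ^+ 2}.
    by move=> x _; rewrite sqr_ge0.
  have /= <- := ge0_integration_by_substitutionNy cW W0.
  apply: le_lt_trans If; apply: ge0_subset_integral => //; first exact: m2.
  by move=> x _; rewrite lee_fin sqr_ge0.
have : (\int[mu]_(x in `[X, +oo[) (2 * c)%:E < +oo)%E.
  apply: (@le_lt_trans _ _ (\int[mu]_(x in `[X, +oo[)
      ((f x ^+ 2)%:E + (f (- x) ^+ 2)%:E))%E).
    apply: ge0_le_integral => //.
    - by move=> x _; rewrite lee_fin mulr_ge0// ltW.
    - by apply: emeasurable_funD; [exact: m2|exact: mN].
    - move=> x /=; rewrite in_itv /= andbT => xX; rewrite -EFinD lee_fin fE fNE.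
      by have := gc x xX; lra.
  rewrite ge0_integralD//; [exact: lte_add_pinfty| |exact: m2| |exact: mN].
  - by move=> x _; rewrite lee_fin sqr_ge0.
  - by move=> x _; rewrite lee_fin sqr_ge0.
rewrite integral_cst//= lebesgue_measure_itv /= ltry.
by rewrite addye// gt0_muley ?lte_fin ?mulr_gt0// ltxx.
Qed.

End square_integrable.

(** * Eigenvectors of the harmonic oscillator *)

Section eigenvectors.
Variable R : realType.
Implicit Types (Om : set R) (x y l h nu s : R) (b : bool).
Local Notation C := R[i].
Local Notation mu := (@lebesgue_measure R).

Definition cosc b nu s x : C := (osc b nu s x)%:C%C.

Let ReB (z w : C) : complex.Re (z - w) = complex.Re z - complex.Re w.
Proof. by case: z w => ? ? []. Qed.

Let ImB (z w : C) : complex.Im (z - w) = complex.Im z - complex.Im w.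
Proof. by case: z w => ? ? []. Qed.

Let ReMr (r : R) (z : C) : complex.Re (r%:C%C * z) = r * complex.Re z.
Proof. by case: z => a c /=; rewrite mul0r subr0. Qed.

Let ImMr (r : R) (z : C) : complex.Im (r%:C%C * z) = r * complex.Im z.
Proof. by case: z => a c /=; rewrite mul0r addr0. Qed.

Let iE (a c : R) : ('i)%C * Complex a c = Complex (- c) a :> C.
Proof. by apply/eqP; rewrite eq_complex /=; apply/andP; split; apply/eqP; ring. Qed.

Let ReD (z w : C) : complex.Re (z + w) = complex.Re z + complex.Re w.
Proof. by case: z w => ? ? []. Qed.

Let ImD (z w : C) : complex.Im (z + w) = complex.Im z + complex.Im w.
Proof. by case: z w => ? ? []. Qed.

Lemma Re_cosc (alpha : C) b nu s x :
  complex.Re (alpha * cosc b nu s x) = complex.Re alpha * osc b nu s x.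
Proof. by rewrite mulrC ReMr mulrC. Qed.

Lemma Im_cosc (alpha : C) b nu s x :
  complex.Im (alpha * cosc b nu s x) = complex.Im alpha * osc b nu s x.
Proof. by rewrite mulrC ImMr mulrC. Qed.

Lemma osc_cts b nu s : continuous (osc b nu s).
Proof. by move=> x; exact: is_derive_cts (is_derive_osc b nu s x). Qed.

(** The equation reads [u'' = potential h l x * u]. *)
Let potential h l x : R := (x ^+ 2 - l) / h ^+ 2.

Let potentialE h l x : 0 < h ->
  potential h l x = (Num.sqrt h)^-1 ^+ 2 * (((Num.sqrt h)^-1 * x) ^+ 2 - l / h).
Proof.
move=> h0; have hn := lt0r_neq0 h0.
rewrite exprMn exprVn sqr_sqrtr ?ltW// /potential.
by field.
Qed.

(** The first-order system [u' = i v], [v' = i w] couples the real part of [u] with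
    the imaginary part of [v] only, and conversely; each pair is a real solution of
    the oscillator equation, with [s = h ^ (- 1/2)] and [nu = l / h]. *)
Lemma eigenvector_span Om h l (u : R -> C) : open Om -> Om 0 ->
  (forall x t, Om x -> `|t| <= `|x| -> 0 <= t * x -> Om t) -> 0 < h ->
  eigenvector Om (fun x => x ^+ 2) h l u ->
  exists alpha beta : C, forall x, Om x ->
    u x = alpha * cosc false (l / h) (Num.sqrt h)^-1 x
        + beta * cosc true (l / h) (Num.sqrt h)^-1 x.
Proof.
move=> oOm Om0 Ostar h0 [_ _ _ [v [w [Dv Dw E]]]].
set s := (Num.sqrt h)^-1.
have s0 : s != 0 by rewrite invr_eq0 gt_eqF// sqrtr_gt0.
have h2 : h ^+ 2 != 0 by rewrite expf_neq0// gt_eqF.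
pose k x := - potential h l x.
have ck : continuous k.
  move=> x; apply: cvgN; apply: cvgM; last exact: cvg_cst.
  by apply: cvgB; [exact: exprn_continuous|exact: cvg_cst].
have wE (P : C -> R) : (forall r z, P (r%:C%C * z) = r * P z) ->
    (forall z z', P (z + z') = P z + P z') ->
    {ae mu, forall x, Om x -> P (w x) = k x * P (u x)}.
  move=> PZ PD; move: E; apply: filterS; first exact: (ae_filter_ringOfSetsType mu).
  move=> x H /H /(congr1 P); rewrite PZ PD !PZ /k /potential => e.
  apply: (mulfI h2); move: (P (w x)) (P (u x)) e => W U e.
  rewrite [RHS](_ : _ = - (x ^+ 2 - l) * U); first by lra.
  by field; rewrite gt_eqF.
have solve (f g : R -> R) :
    (forall x, Om x -> is_derive x (1 : R) f (g x)) ->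
    (forall x, Om x -> is_derive x (1 : R) g (- (k x * f x))) ->
    exists al be : R, forall x, Om x ->
      f x = al * osc false (l / h) s x + be * osc true (l / h) s x.
  move=> df dg; exists (f 0), (g 0 / s) => x Omx.
  apply: (osc_span s0 Om0 Ostar df _ Omx) => t Omt.
  by rewrite -potentialE// -[potential _ _ _]opprK -/(k t) mulNr; exact: dg.
have PRe x y : x <= y -> `[x, y] `<=` Om ->
    mu.-integrable `[x, y] (EFin \o (fun t => complex.Im (v t))) /\
    complex.Re (u y) - complex.Re (u x)
      = -1 * \int[mu]_(t in `[x, y]) complex.Im (v t).
  move=> xy /(Dv x y xy)[[_ iI] e]; split => //.
  by rewrite -ReB e /Cintegral iE /= mulN1r.
have PIm x y : x <= y -> `[x, y] `<=` Om ->
    mu.-integrable `[x, y] (EFin \o (fun t => complex.Re (v t))) /\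
    complex.Im (u y) - complex.Im (u x)
      = 1 * \int[mu]_(t in `[x, y]) complex.Re (v t).
  move=> xy /(Dv x y xy)[[iR _] e]; split => //.
  by rewrite -ImB e /Cintegral iE /= mul1r.
have QRe x y : x <= y -> `[x, y] `<=` Om ->
    mu.-integrable `[x, y] (EFin \o (fun t => complex.Im (w t))) /\
    complex.Re (v y) - complex.Re (v x)
      = -1 * \int[mu]_(t in `[x, y]) complex.Im (w t).
  move=> xy /(Dw x y xy)[[_ iI] e]; split => //.
  by rewrite -ReB e /Cintegral iE /= mulN1r.
have QIm x y : x <= y -> `[x, y] `<=` Om ->
    mu.-integrable `[x, y] (EFin \o (fun t => complex.Re (w t))) /\
    complex.Im (v y) - complex.Im (v x)
      = 1 * \int[mu]_(t in `[x, y]) complex.Re (w t).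
  move=> xy /(Dw x y xy)[[iR _] e]; split => //.
  by rewrite -ImB e /Cintegral iE /= mul1r.
have [a1 [b1 Eu1]] : exists al be : R, forall x, Om x ->
    complex.Re (u x) = al * osc false (l / h) s x + be * osc true (l / h) s x.
  have H := weak_ode oOm PRe QIm (wE (@complex.Re R) ReMr ReD) ck.
  apply: (solve (fun x => complex.Re (u x)) (fun x => -1 * complex.Im (v x))) => x Omx.
    by case: (H x Omx).
  have [_ d2] := H x Omx.
  by apply: is_derive_eq; rewrite /GRing.scale /=; ring.
have [a2 [b2 Eu2]] : exists al be : R, forall x, Om x ->
    complex.Im (u x) = al * osc false (l / h) s x + be * osc true (l / h) s x.
  have H := weak_ode oOm PIm QRe (wE (@complex.Im R) ImMr ImD) ck.
  apply: (solve (fun x => complex.Im (u x)) (fun x => 1 * complex.Re (v x))) => x Omx.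
    by case: (H x Omx).
  have [_ d2] := H x Omx.
  by apply: is_derive_eq; rewrite /GRing.scale /=; ring.
exists (Complex a1 a2), (Complex b1 b2) => x Omx.
apply/eqP; rewrite eq_complex ReD ImD !Re_cosc !Im_cosc /=.
by rewrite Eu1// Eu2// !eqxx.
Qed.

Lemma osc_eigenvector Om b nu h : 0 < h ->
  (osc b nu (Num.sqrt h)^-1) \_ Om \in Lfun mu 2%:E ->
  (forall x, closure Om x -> ~ Om x -> osc b nu (Num.sqrt h)^-1 x = 0) ->
  eigenvector Om (fun x => x ^+ 2) h (h * nu) (cosc b nu (Num.sqrt h)^-1).
Proof.
move=> h0 L2u bc; set s := (Num.sqrt h)^-1 in L2u bc *.
have h2 : h ^+ 2 != 0 by rewrite expf_neq0// gt_eqF.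
have L0 : (fun=> 0 : R) \_ Om \in Lfun mu 2%:E.
  rewrite (_ : _ \_ _ = cst 0).
    apply: (@gauss_dominated_Lfun2 _ _ 0 1) => //; first exact: cst_continuous.
    by move=> x; rewrite mul0r expr0n.
  by apply/funext => x; rewrite patchE; case: ifP.
pose q x := potential h (h * nu) x.
have qE x : q x = s ^+ 2 * ((s * x) ^+ 2 - nu).
  rewrite /q potentialE//; congr (_ * (_ - _)).
  by rewrite mulrAC divff ?mul1r// gt_eqF.
have dq x : is_derive x (1 : R) (dosc b nu s) (q x * osc b nu s x).
  by rewrite qE; exact: is_derive_dosc.
have cd : continuous (dosc b nu s) by move=> x; exact: is_derive_cts (dq x).
have cq : continuous (fun x => q x * osc b nu s x).
  move=> x; apply: cvgM; last exact: osc_cts.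
  apply: cvgM; last exact: cvg_cst.
  by apply: cvgB; [exact: exprn_continuous|exact: cvg_cst].
have I0 x y : \int[mu]_(t in `[x, y]) (0 : R) = 0.
  by rewrite /Rintegral integral0_eq.
have IN (F f : R -> R) x y : x <= y -> continuous f ->
    (forall t, is_derive t (1 : R) F (f t)) ->
    \int[mu]_(t in `[x, y]) (- f t) = - (F y - F x).
  move=> xy cf dF.
  have -> : - (F y - F x) = - F y - - F x by ring.
  have dN t : x <= t <= y -> is_derive t (1 : R) (fun t => - F t) (- f t).
    by move=> _; have := dF t => dFt; exact: is_deriveN.
  have cN : {within `[x, y], continuous (fun t => - f t)}.
    by apply: continuous_subspaceT => t; apply: cvgN; exact: cf.
  exact: (Rintegral_is_derive xy dN cN).
have iN (f : R -> R) x y : continuous f ->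
    mu.-integrable `[x, y] (EFin \o (fun t => - f t)).
  move=> cf; apply: continuous_segment_integrable.
  by apply: continuous_subspaceT => t; apply: cvgN; exact: cf.
have i0 x y : mu.-integrable `[x, y] (EFin \o (fun t => 0 : R)).
  apply: continuous_segment_integrable.
  by apply: continuous_subspaceT; exact: cst_continuous.
split.
- by split => //=.
- split => /=.
    rewrite (_ : _ \_ _ = (h * nu) \o* (osc b nu s \_ Om)); last first.
      apply/funext => x /=; rewrite !patchE /=; case: ifP => _; last by rewrite mul0r.
      by rewrite mulr0 subr0 mulrC.
    by apply: Lfun_scale => //; rewrite ler1n.
  rewrite (_ : _ \_ _ = (fun=> 0) \_ Om)//.
  by congr (_ \_ Om); apply/funext => x /=; rewrite mulr0 mul0r addr0.
- move=> x clx nx; rewrite /cosc /=; split; last exact: cvg_cst.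
  rewrite -[X in _ --> X](bc x clx nx).
  by apply: cvg_within_filter; exact: osc_cts.
- exists (fun x => Complex 0 (- dosc b nu s x)),
    (fun x => (- (q x * osc b nu s x))%:C%C); split.
  + move=> x y xy _; rewrite /Cintegrable /Cintegral /=; split.
      by split; [exact: i0|exact: iN].
    rewrite I0 iE (IN _ _ x y xy cd (is_derive_osc b nu s)).
    by rewrite opprK /cosc -rmorphB.
  + move=> x y xy _; rewrite /Cintegrable /Cintegral /=; split.
      by split; [exact: iN|exact: i0].
    rewrite I0 iE (IN _ _ x y xy cq dq).
    by apply/eqP; rewrite eq_complex /= subrr oppr0 opprD !eqxx.
  + apply: aeW => x Omx; apply/eqP; rewrite eq_complex ReD ImD !ReMr !ImMr /=.
    rewrite !mulr0 addr0 eqxx andbT /q /potential; apply/eqP.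
    by field; rewrite gt_eqF.
Qed.

End eigenvectors.

(** * Numbering the eigenvalues *)

Section numbering.
Variable R : realType.
Implicit Types (Om : set R) (x s : R).
Local Notation C := R[i].
Local Notation mu := (@lebesgue_measure R).

Let derive_eq0 (f : R -> R) df Om x : open Om -> (forall y, Om y -> f y = 0) ->
  Om x -> is_derive x (1 : R) f df -> df = 0.
Proof.
move=> oOm f0 Omx [_ <-].
have D0 : is_derive x (1 : R) f 0.
  have d0 := is_derive_cst (0 : R) x (1 : R).
  apply: near_eq_is_derive d0.
  by near=> t; rewrite f0//; near: t; exact: open_nbhs_nbhs.
by case: D0.
Unshelve. all: by end_near. Qed.

Let osc_neq0 Om b (nu s : R) : open Om -> Om 0 -> s != 0 ->
  ~ (forall x, Om x -> osc b nu s x = 0).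
Proof.
move=> oOm Om0 s0 H; case: b H => H.
  have := derive_eq0 oOm H Om0 (is_derive_osc true nu s 0).
  by rewrite dosc_at0 mulr1 => /eqP; rewrite (negbTE s0).
by have := H 0 Om0; rewrite osc_at0 => /eqP; rewrite oner_eq0.
Qed.

Let is_derive_osc_sum n (b : 'I_n -> bool) (nu t : 'I_n -> R) s x :
  is_derive x (1 : R) (fun x => \sum_(i < n) t i * osc (b i) (nu i) s x)
    (\sum_(i < n) t i * dosc (b i) (nu i) s x).
Proof.
have -> : (fun x => \sum_(i < n) t i * osc (b i) (nu i) s x) =
    \sum_(i < n) (fun x => t i * osc (b i) (nu i) s x).
  by apply/funext => y; rewrite fct_sumE.
apply: is_derive_sum => i; have := is_derive_osc (b i) (nu i) s x => d.
by apply: is_derive_eq; rewrite /GRing.scale /=; ring.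
Qed.

(** Two derivatives turn a linear relation into the same relation weighted by the
    eigenvalues, hence by any polynomial in them; a Lagrange polynomial then
    isolates one term. *)
Lemma osc_independent n Om (b : 'I_n -> bool) (nu : 'I_n -> R) s (r : 'I_n -> R) :
  open Om -> Om 0 -> s != 0 -> injective nu ->
  (forall x, Om x -> \sum_(i < n) r i * osc (b i) (nu i) s x = 0) ->
  forall i, r i = 0.
Proof.
move=> oOm Om0 s0 nu_inj rel.
have twice (t : 'I_n -> R) :
    (forall x, Om x -> \sum_(i < n) t i * osc (b i) (nu i) s x = 0) ->
    forall x, Om x -> \sum_(i < n) t i * nu i * osc (b i) (nu i) s x = 0.
  move=> t0.
  have d1 x : Om x -> \sum_(i < n) t i * dosc (b i) (nu i) s x = 0.
    by move=> Omx; exact: (derive_eq0 oOm t0 Omx (is_derive_osc_sum b nu t s x)).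
  move=> x Omx.
  have : \sum_(i < n) t i * (s ^+ 2 * ((s * x) ^+ 2 - nu i) * osc (b i) (nu i) s x) = 0.
    apply: (derive_eq0 oOm d1 Omx).
    have -> : (fun x => \sum_(i < n) t i * dosc (b i) (nu i) s x) =
        \sum_(i < n) (fun x => t i * dosc (b i) (nu i) s x).
      by apply/funext => y; rewrite fct_sumE.
    apply: is_derive_sum => i; have := is_derive_dosc (b i) (nu i) s x => d.
    by apply: is_derive_eq; rewrite /GRing.scale /=; ring.
  rewrite (eq_bigr (fun i => s ^+ 2 * (s * x) ^+ 2 * (t i * osc (b i) (nu i) s x)
    - s ^+ 2 * (t i * nu i * osc (b i) (nu i) s x))); last by move=> i _; ring.
  rewrite sumrB -!mulr_sumr t0// mulr0 sub0r => /eqP.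
  by rewrite oppr_eq0 mulf_eq0 sqrf_eq0 (negbTE s0) => /eqP.
have weighted (q : {poly R}) x : Om x ->
    \sum_(i < n) r i * q.[nu i] * osc (b i) (nu i) s x = 0.
  elim/poly_ind: q x => [|q c IHq] x Omx.
    by apply: big1 => i _; rewrite horner0 mulr0 mul0r.
  rewrite (eq_bigr (fun i => r i * q.[nu i] * nu i * osc (b i) (nu i) s x
    + c * (r i * osc (b i) (nu i) s x))); last first.
    by move=> i _; rewrite hornerMXaddC; ring.
  rewrite big_split /= -mulr_sumr rel// mulr0 addr0.
  exact: twice.
move=> i; apply/eqP/negPn/negP => ri.
pose q := \prod_(j < n | j != i) ('X - (nu j)%:P).
have q0 : q.[nu i] != 0.
  rewrite horner_prod; apply/prodf_neq0 => j ji.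
  rewrite hornerXsubC subr_eq0; apply: contra ji => /eqP/nu_inj ->.
  exact: eqxx.
apply: (osc_neq0 (b := b i) (nu := nu i) oOm Om0 s0) => x Omx.
have := weighted q x Omx; rewrite (bigD1 i)//= big1 ?addr0.
  by move=> /eqP; rewrite mulf_eq0 mulf_eq0 (negbTE ri) (negbTE q0) => /eqP.
move=> j ji; rewrite horner_prod (bigD1 j)//= hornerXsubC subrr mul0r.
by rewrite mulr0 mul0r.
Qed.

Let Re_sum n (F : 'I_n -> C) :
  complex.Re (\sum_(i < n) F i) = \sum_(i < n) complex.Re (F i).
Proof. by apply: (big_morph (@complex.Re R)) => // -[? ?] []. Qed.

Let Im_sum n (F : 'I_n -> C) :
  complex.Im (\sum_(i < n) F i) = \sum_(i < n) complex.Im (F i).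
Proof. by apply: (big_morph (@complex.Im R)) => // -[? ?] []. Qed.

Lemma lin_indep_cosc n Om (b : 'I_n -> bool) (nu : 'I_n -> R) s :
  open Om -> Om 0 -> s != 0 -> injective nu ->
  lin_indep Om (fun i => cosc (b i) (nu i) s).
Proof.
move=> oOm Om0 s0 nu_inj c c0 i.
have part (P : C -> R) : P 0 = 0 ->
    (forall F : 'I_n -> C, P (\sum_(i < n) F i) = \sum_(i < n) P (F i)) ->
    (forall a b nu x, P (a * cosc b nu s x) = P a * osc b nu s x) -> P (c i) = 0.
  move=> P0 PS PZ.
  apply: (@osc_independent n Om b nu s (fun i => P (c i))) => // x.
  have cts y := is_derive_cts (is_derive_osc_sum b nu (fun i => P (c i)) s y).
  apply: (ae0_continuous_eq0 oOm cts).
  move: c0; apply: filterS; first exact: (ae_filter_ringOfSetsType mu).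
  move=> y H /H /(congr1 P); rewrite PS P0 => e; rewrite -[RHS]e.
  by apply: eq_bigr => j _; rewrite PZ.
apply/eqP; rewrite eq_complex.
rewrite (part (@complex.Re R) erefl (@Re_sum n))/=; last by move=> *; exact: Re_cosc.
rewrite (part (@complex.Im R) erefl (@Im_sum n)) ?eqxx//.
by move=> *; exact: Im_cosc.
Qed.

(** As an eigenvector is a combination of the even and the odd solution, it suffices
    to know which solutions are modes: the last hypothesis says that a parity which
    occurs in an eigenvector does so at one of the first [m] listed values. *)
Lemma nth_eigenvalue_osc Om (h : R) (m : nat) (nu : nat -> R) : open Om -> Om 0 ->
  (forall x t, Om x -> `|t| <= `|x| -> 0 <= t * x -> Om t) -> 0 < h ->
  (forall i j, (i < j)%N -> (j <= m)%N -> nu i < nu j) ->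
  (forall i, (i <= m)%N -> eigenvector Om (fun x => x ^+ 2) h (h * nu i)
    (cosc (odd i) (nu i) (Num.sqrt h)^-1)) ->
  (forall k u (gam : bool -> C), k < h * nu m ->
    eigenvector Om (fun x => x ^+ 2) h k u ->
    (forall x, Om x -> u x = gam false * cosc false (k / h) (Num.sqrt h)^-1 x
                           + gam true * cosc true (k / h) (Num.sqrt h)^-1 x) ->
    forall b, gam b != 0 -> exists i, [/\ (i < m)%N, odd i = b & k / h = nu i]) ->
  nth_eigenvalue Om (fun x => x ^+ 2) h m (h * nu m).
Proof.
move=> oOm Om0 Ostar h0 nuS eig complete; set s := (Num.sqrt h)^-1 in eig complete *.
have s0 : s != 0 by rewrite invr_eq0 gt_eqF// sqrtr_gt0.
exists (fun i : 'I_m.+1 => h * nu i), (fun i : 'I_m.+1 => cosc (odd i) (nu i) s).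
split => //.
- move=> i j; rewrite leq_eqVlt => /orP[/eqP/val_inj ->//|ij].
  by rewrite ler_wpM2l ?(ltW h0)// ltW// nuS// -ltnS.
- by move=> i; apply: eig; rewrite -ltnS.
- apply: (@lin_indep_cosc m.+1 Om (fun i => odd i) (fun i => nu i)) => //.
  move=> i j E; apply: val_inj; have iM := ltn_ord i; have jM := ltn_ord j.
  case: (ltngtP (nat_of_ord i) (nat_of_ord j)) => // ij.
    by have := nuS _ _ ij jM; rewrite E ltxx.
  by have := nuS _ _ ij iM; rewrite E ltxx.
- move=> k u km eu.
  have [al [be uE]] := eigenvector_span oOm Om0 Ostar h0 eu.
  pose gam (b : bool) := if b then be else al.
  have mode b : exists c : 'I_m.+1 -> C, forall x, gam b * cosc b (k / h) s x =
      \sum_(i < m.+1 | (i < m)%N) c i * cosc (odd i) (nu i) s x.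
    have [->|gb] := eqVneq (gam b) 0.
      by exists (fun=> 0) => x; rewrite mul0r big1// => i _; rewrite mul0r.
    have [i [im ib kE]] := complete k u gam km eu uE b gb.
    exists (fun j : 'I_m.+1 => if j == inord i then gam b else 0) => x.
    have iE : nat_of_ord (inord i : 'I_m.+1) = i by rewrite inordK// ltnS ltnW.
    rewrite (bigD1 (inord i)) ?iE//= eqxx ib -kE big1 ?addr0// => j /andP[_ ji].
    by rewrite (negbTE ji) mul0r.
  have [c0 H0] := mode false; have [c1 H1] := mode true.
  exists (fun i => c0 i + c1 i); apply: aeW => x Omx.
  rewrite uE// -[al]/(gam false) -[be]/(gam true) H0 H1 -big_split /=.
  by apply: eq_bigr => i _; rewrite mulrDl.
Qed.

End numbering.

Section whole_line.
Variable R : realType.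
Implicit Types (x s h : R).
Local Notation C := R[i].
Local Notation mu := (@lebesgue_measure R).

Let oscE b nu s x :
  osc b nu s x = expR (- ((s * x) ^+ 2 / 2)) * hermite b (osc_param b nu) (s * x).
Proof. by []. Qed.

(** At these parameters the series terminates, and a polynomial times a Gaussian is
    left. *)
Lemma osc_hermite_Lfun2 (b : bool) n s : 0 < s ->
  osc b (2 * (2 * n + b)%:R + 1) s \in Lfun mu 2%:E.
Proof.
move=> s0; set nu := _ + 1.
have pE : osc_param b nu = - n%:R.
  by rewrite /osc_param /nu natrD natrM; field.
pose T k : R := 4 ^+ k * k`!%:R.
pose S := \sum_(k < n.+1) `|kcoef b (- n%:R : R) k| * (T k + T k.+1).
have powle (z : R) k : 0 <= z -> z ^+ k <= T k * expR (z / 4).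
  move=> z0; have y0 : 0 <= z / 4 by rewrite divr_ge0.
  case: k => [|k].
    rewrite /T !expr0 fact0 !mul1r; apply: le_trans (expR_ge1Dx _).
    by rewrite lerDl.
  have f0 : 0 < k.+1`!%:R :> R by rewrite ltr0n fact_gt0.
  have : (z / 4) ^+ k.+1 / k.+1`!%:R <= expR (z / 4).
    by have := expR_ge1Dxn k y0; apply: le_trans; rewrite lerDr ler01.
  rewrite expr_div_n ler_pdivrMr// ler_pdivrMr ?exprn_gt0// => /le_trans; apply.
  by rewrite /T le_eqVlt; apply/orP; left; apply/eqP; ring.
have herm y : `|hermite b (osc_param b nu) y| <= S * expR (y ^+ 2 / 4).
  have z0 : 0 <= y ^+ 2 by rewrite sqr_ge0.
  have yz : `|y ^+ b| <= 1 + y ^+ 2.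
    rewrite normrX; case: (b); rewrite ?expr0 ?expr1 ?lerDl//.
    rewrite -real_normK ?num_real//.
    have := sqr_ge0 (`|y| - 1); have := sqr_ge0 `|y|.
    by move: `|y| => t; rewrite !expr2 => h1 h2; lra.
  rewrite /hermite pE; move: (y ^+ 2) z0 yz => z z0 yz.
  have -> : kummer b (- n%:R) z = \sum_(k < n.+1) kcoef b (- n%:R) k * z ^+ k.
    rewrite (kummer_split n.+1) [X in _ + X](_ : _ = 0) ?addr0//.
    by rewrite pochS addNr mulr0 !mul0r.
  rewrite normrM; apply: le_trans (ler_wpM2r (normr_ge0 _) yz) _.
  have z1 : 0 <= 1 + z by rewrite addr_ge0.
  apply: le_trans (ler_wpM2l z1 (ler_norm_sum _ _ _)) _.
  rewrite /S mulr_suml mulr_sumr; apply: ler_sum => k _.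
  rewrite normrM (ger0_norm (exprn_ge0 _ z0)) mulrCA -[leRHS]mulrA ler_wpM2l//.
  have := powle z k z0; have := powle z k.+1 z0.
  by rewrite exprS; lra.
apply: (@gauss_dominated_Lfun2 _ _ (S ^+ 2) s) => //; first exact: osc_cts.
move=> x; rewrite oscE; move: (s * x) => y.
have := herm y; move: (hermite _ _ _) => H Hle.
have H2 : H ^+ 2 <= (S * expR (y ^+ 2 / 4)) ^+ 2.
  by rewrite -[H ^+ 2]real_normK ?num_real// lerXn2r ?nnegrE// (le_trans _ Hle).
rewrite exprMn; apply: le_trans (ler_wpM2l (sqr_ge0 _) H2) _.
rewrite exprMn mulrCA ler_wpM2l ?sqr_ge0// !expr2 -!expRD.
by rewrite ler_expR -expr2 le_eqVlt; apply/orP; left; apply/eqP; field.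
Qed.

Lemma nth_eigenvalue_line h m : 0 < h ->
  nth_eigenvalue [set: R] (fun x => x ^+ 2) h m (h * (2 * m%:R + 1)).
Proof.
move=> h0; set s := (Num.sqrt h)^-1.
have s0 : 0 < s by rewrite invr_gt0 sqrtr_gt0.
pose nu (i : nat) : R := 2 * i%:R + 1.
rewrite -/(nu m).
have oddE i : (2 * i./2 + odd i)%N = i by rewrite addnC mul2n odd_double_half.
apply: nth_eigenvalue_osc => //; first exact: openT.
- by move=> i j ij _; rewrite /nu ltrD2r ltr_pM2l// ltr_nat.
- move=> i _; apply: osc_eigenvector => //; last by move=> x _ [].
  rewrite patch_setT.
  by have := @osc_hermite_Lfun2 (odd i) i./2 s s0; rewrite oddE.
move=> k u gam km [[L2re L2im] _ _ _] uE b gb.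
set la := k / h.
have laM : la < nu m by rewrite ltr_pdivrMr// mulrC.
have [[n nE]|aN] := pselect (exists n : nat, osc_param b la = - n%:R).
  have laE : la = nu (2 * n + b)%N.
    rewrite /nu natrD natrM.
    by move: nE; rewrite /osc_param => /(canRL (mulfK _)) H; have := H; lra.
  exists (2 * n + b)%N; split => //.
    by move: laM; rewrite laE /nu ltrD2r ltr_pM2l// ltr_nat.
  by rewrite oddD oddM /= oddb.
exfalso; move: gb => /eqP; apply; apply/eqP; rewrite eq_complex.
have grow : exists X : R, forall x, X <= x -> 1 <= osc b la s x ^+ 2.
  have aN' (n : nat) : osc_param b la != - n%:R.
    by apply/eqP => H; apply: aN; exists n.
  have [X X1 HX] := kummer_growth b aN'.
  exists (X / s) => x; rewrite ler_pdivrMr// mulrC => Xx.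
  have H := HX _ Xx.
  rewrite -real_normK ?num_real//; apply: exprn_ege1.
  by rewrite oscE normrM (ger0_norm (expR_ge0 _)) mulrC.
have part (P : C -> R) : (fun x => P (u x)) \in Lfun mu 2%:E ->
    (forall z z', P (z + z') = P z + P z') ->
    (forall a b nu x, P (a * cosc b nu s x) = P a * osc b nu s x) -> P (gam b) = 0.
  move=> PL PD PZ; apply/eqP; apply: contraT => Pb.
  have [X HX] := grow.
  pose g c x := P (gam c) * osc c la s x.
  have uPE x : P (u x) = g false x + g true x by rewrite uE// PD !PZ.
  have : (fun x => P (u x)) \notin Lfun mu 2%:E.
    apply: (@parity_not_Lfun2 _ _ (g false) (g true) X (P (gam b) ^+ 2)) => //.
    - have -> : (fun x => P (u x)) = (fun x => g false x + g true x).
        by apply/funext.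
      move=> x; apply: cvgD; apply: cvgM; (exact: cvg_cst || exact: osc_cts).
    - by move=> x; rewrite uPE /g !oscN expr0 expr1; ring.
    - move=> x /HX H.
      have : P (gam b) ^+ 2 <= g b x ^+ 2.
        by rewrite exprMn ler_peMr// sqr_ge0.
      have : 0 <= g false x ^+ 2 by rewrite sqr_ge0.
      have : 0 <= g true x ^+ 2 by rewrite sqr_ge0.
      by case: (b); lra.
    - by rewrite exprn_even_gt0.
  by rewrite PL.
rewrite patch_setT in L2re; rewrite patch_setT in L2im.
rewrite (part (@complex.Re R))//; [|by case=> ? ? []|by move=> *; exact: Re_cosc].
rewrite (part (@complex.Im R)) ?eqxx//; [by case=> ? ? []|by move=> *; exact: Im_cosc].
Qed.

End whole_line.

Section bounded_interval.
Variable R : realType.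
Implicit Types (a x h : R).
Local Notation C := R[i].
Local Notation mu := (@lebesgue_measure R).

(** [d] is the shift of the [j]-th eigenvalue in units of [4 * h], when the
    half-width of the interval is [x] in units of [sqrt h]. *)
Definition shift_of j (x d : R) := 0 < d <= 4^-1 /\
  forall d', 0 <= d' < 1 ->
    kummer (odd j) (- j./2%:R - d') (x ^+ 2) = 0 <-> d' = d.

Lemma half_oddE j : (2 * j./2 + odd j)%N = j.
Proof. by rewrite addnC mul2n odd_double_half. Qed.

Lemma shift_of_exists m : exists2 Z : R, 1 <= Z & forall x, 0 < x -> Z <= x ^+ 2 ->
  forall j, (j <= m)%N -> exists d, shift_of j x d.
Proof.
have one j : exists2 Z : R, 1 <= Z & forall x, 0 < x -> Z <= x ^+ 2 ->
    exists d, shift_of j x d.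
  have [Z [? [Z1 _ H]]] := kummer_parameter_zero R (odd j) j./2.
  by exists Z => // x x0 xZ; have [d [d0 dP _]] := H x x0 xZ; exists d.
elim: m => [|m [Z Z1 IH]].
  have [Z Z1 H] := one 0%N; exists Z => // x x0 xZ j.
  by rewrite leqn0 => /eqP ->; exact: H.
have [Z' Z'1 H] := one m.+1.
exists (Z + Z'); first by lra.
move=> x x0 xZ j; rewrite leq_eqVlt => /predU1P[->|]; first by apply: H => //; lra.
by rewrite ltnS; apply: IH => //; lra.
Qed.

Lemma osc_param_shift j (d : R) :
  osc_param (odd j) (2 * j%:R + 1 + 4 * d) = - j./2%:R - d.
Proof.
rewrite /osc_param -[in j%:R](half_oddE j) natrD natrM.
by field.
Qed.

Let osc_eq0 b (nu s x : R) : s * x != 0 ->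
  osc b nu s x = 0 <-> kummer b (osc_param b nu) ((s * x) ^+ 2) = 0.
Proof.
move=> sx; rewrite /osc /hermite; split => [/eqP|->]; last by rewrite !mulr0.
by rewrite !mulf_eq0 gt_eqF ?expR_gt0//= expf_eq0 (negbTE sx) andbF /= => /eqP.
Qed.

Let closure_boundary a x : closure `]- a, a[ x -> ~ `]- a, a[%classic x ->
  x = a \/ x = - a.
Proof.
move=> /(closureS (@subset_itv_oo_cc _ _ (- a) a)) cl.
have e := (closure_id `[- a, a]%classic).1 (@itv_closed _ _ (- a) a).
have : `[- a, a]%classic x by rewrite e.
rewrite /= !in_itv /= => /andP[ax xa] /negP.
rewrite negb_and -!leNgt => /orP[h|h]; [right|left].
  by apply/le_anti/andP.
by apply/le_anti/andP.
Qed.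

Let boundary a x : 0 < a -> `|x| = a -> closure `]- a, a[ x.
Proof.
move=> a0 xa B /nbhs_ballP[e /= e0 eB].
pose t := e / (e + 2 * a).
have ea : 0 < e + 2 * a by rewrite addr_gt0// mulr_gt0.
have t0 : 0 < t by rewrite divr_gt0.
have t1 : t < 1 by rewrite ltr_pdivrMr// mul1r ltrDl mulr_gt0.
exists ((1 - t) * x); split.
  rewrite /= in_itv /= -ltr_norml normrM xa ger0_norm ?subr_ge0 ?(ltW t1)//.
  by rewrite gtr_pMl// ltrBlDr ltrDl.
apply: eB; rewrite /ball /= (_ : x - _ = t * x); last by ring.
rewrite normrM xa ger0_norm ?(ltW t0)// /t mulrAC ltr_pdivrMr//.
rewrite ltr_pM2l//; lra.
Qed.

(** At both ends an eigenvector vanishes, so its even and its odd part vanish there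
    separately. The series is positive at nonnegative parameters; at the others the
    vanishing of one parity identifies the fractional part [d'] of the parameter as
    the shift of the eigenvalue whose index the integer part determines. *)
Lemma nth_eigenvalue_interval a h m (d : nat -> R) : 0 < a -> 0 < h ->
  (forall j, (j <= m)%N -> shift_of j (a / Num.sqrt h) (d j)) ->
  nth_eigenvalue `]- a, a[ (fun x => x ^+ 2) h m (h * (2 * m%:R + 1 + 4 * d m)).
Proof.
move=> a0 h0 dP; set s := (Num.sqrt h)^-1.
have s0 : 0 < s by rewrite invr_gt0 sqrtr_gt0.
have sa0 : 0 < s * a by rewrite mulr_gt0.
have saE : a / Num.sqrt h = s * a by rewrite mulrC.
pose nu (j : nat) : R := 2 * j%:R + 1 + 4 * d j.
have nu_lo j : (j <= m)%N -> 2 * j%:R + 1 < nu j.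
  by move=> /dP[/andP[? ?] _]; rewrite /nu; lra.
have nu_hi j : (j <= m)%N -> nu j <= 2 * j%:R + 2.
  by move=> /dP[/andP[? ?] _]; rewrite /nu; lra.
have nuP j : (j <= m)%N -> osc (odd j) (nu j) s a = 0.
  move=> jm; have [/andP[d0 d1] H] := dP j jm.
  apply/osc_eq0; first by rewrite gt_eqF.
  rewrite osc_param_shift -saE; apply/H => //.
  by rewrite (ltW d0) (le_lt_trans d1)// invf_lt1// ltr1n.
rewrite -/(nu m).
apply: nth_eigenvalue_osc => //.
- by rewrite /= in_itv /= oppr_lt0 a0.
- move=> x t; rewrite /= !in_itv /= -!ltr_norml => xa tx _.
  exact: le_lt_trans xa.
- move=> i j ij jm; apply: le_lt_trans (nu_hi i (leq_trans (ltnW ij) jm)) _.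
  apply: le_lt_trans (nu_lo j jm).
  have : i.+1%:R <= j%:R :> R by rewrite ler_nat.
  by rewrite -nat1r; lra.
- move=> j jm; apply: osc_eigenvector => //.
    by apply: continuous_Lfun2_itv; exact: osc_cts.
  move=> x clx nx; case: (closure_boundary clx nx) => ->; first exact: nuP.
  by rewrite oscN nuP// mulr0.
move=> k u gam km [_ _ dir _] uE b gb.
set la := k / h in uE *.
have laM : la < nu m by rewrite ltr_pdivrMr// mulrC.
have part (P : C -> R) : (forall c, closure `]- a, a[ c -> ~ `]- a, a[%classic c ->
      P (u x) @[x --> within `]- a, a[ (nbhs c)] --> 0) ->
    (forall z z', P (z + z') = P z + P z') ->
    (forall c b nu x, P (c * cosc b nu s x) = P c * osc b nu s x) ->
    P (gam b) * osc b la s a = 0.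
  move=> PB PD PZ.
  pose f x := P (gam false) * osc false la s x + P (gam true) * osc true la s x.
  have fc c : `|c| = a -> f c = 0.
    move=> ca; have clc := boundary a0 ca.
    have pf : ProperFilter (within `]- a, a[ (nbhs c)) by exact: within_nbhs_proper.
    have nc : ~ `]- a, a[%classic c.
      by rewrite /= in_itv /= -ltr_norml ca ltxx.
    apply: (@cvg_unique _ _ (f x @[x --> within `]- a, a[ (nbhs c)])) => //.
      apply: cvg_within_filter; apply: cvgD; apply: cvgM;
        (exact: cvg_cst || exact: osc_cts).
    have nE : \forall t \near within `]- a, a[ (nbhs c), P (u t) = f t.
      by rewrite near_withinE; apply: nearW => t Omt; rewrite uE// PD !PZ.
    by apply: cvg_trans (PB c clc nc); exact: near_eq_cvg nE.
  have f1 := fc a (ger0_norm (ltW a0)).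
  have f2 : f (- a) = 0 by apply: fc; rewrite normrN ger0_norm// ltW.
  move: f1 f2; rewrite /f !oscN expr0 expr1; case: (b); lra.
have z0 : osc b la s a = 0.
  apply/eqP; apply: contraR gb => on; rewrite eq_complex.
  have P1 := part (@complex.Re R) (fun c cl nc => (dir c cl nc).1).
  have P2 := part (@complex.Im R) (fun c cl nc => (dir c cl nc).2).
  apply/andP; split; rewrite -(mulIr_eq0 _ (mulIf on)).
    by rewrite P1//; [case=> ? ? []|move=> *; exact: Re_cosc].
  by rewrite P2//; [case=> ? ? []|move=> *; exact: Im_cosc].
move: z0 => /osc_eq0; rewrite gt_eqF// => /(_ isT) K0.
have pneg : osc_param b la < 0.
  rewrite ltNge; apply/negP => p0.
  by have := kummer_gt0 b p0 (sqr_ge0 (s * a)); rewrite K0 ltxx.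
have al0 : 0 <= - osc_param b la by rewrite oppr_ge0 ltW.
pose n := Num.truncn (- osc_param b la).
have /andP[n1 n2] := truncn_itv al0; rewrite -/n in n1 n2.
pose d' := - osc_param b la - n%:R.
have d'I : 0 <= d' < 1.
  by rewrite /d' subr_ge0 n1 ltrBlDr nat1r.
pose j := (2 * n + b)%N.
have laE : la = 2 * j%:R + 1 + 4 * d'.
  by rewrite /j natrD natrM /d' /osc_param; field.
have jm : (j <= m)%N.
  rewrite -ltnS -(ltr_nat R) -nat1r.
  have := nu_hi m (leqnn m); have /andP[? ?] := d'I; lra.
have oj : odd j = b by rewrite oddD oddM /= oddb.
have hj : j./2 = n.
  by rewrite /j addnC mul2n half_bit_double.
have dj : d' = d j.
  have [_ H] := dP j jm; apply/H => //.
  by rewrite oj hj saE -K0; congr (kummer b _ _); rewrite /d'; ring.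
have laj : la = nu j by rewrite laE dj.
exists j; split => //.
rewrite ltn_neqAle jm andbT; apply/eqP => jE.
by move: laM; rewrite laj jE ltxx.
Qed.

End bounded_interval.

Theorem corollary1p1 (R : realType) :
  (forall (h : R) (m : nat), 0 < h ->
     nth_eigenvalue [set: R] (fun x => x ^+ 2) h m ((2 * m%:R + 1) * h)) /\
  (forall m : nat, exists eps C : R, 0 < eps /\ 0 < C /\
     forall a h : R, 0 < a -> 0 < h -> a ^- 2 * h < eps ->
       exists lam rho : R,
         nth_eigenvalue `]- a, a[ (fun x => x ^+ 2) h m lam /\
         `|rho| <= C * (a ^- 2 * h) /\
         lam = (2 * m%:R + 1) * h
               + h `^ (2^-1 - m%:R) * 2 ^+ (2 + m) / (m`!%:R * pi `^ 2^-1)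
                 * a ^+ (2 * m + 1) * expR (- (a ^+ 2 / h)) * (1 + rho)).
Proof.
split=> [h m h0|m].
  by rewrite [X in nth_eigenvalue _ _ _ _ X]mulrC; exact: nth_eigenvalue_line.
have [Z [C [Z1 C0 H]]] := kummer_parameter_zero R (odd m) m./2.
have [Z' Z'1 H'] := shift_of_exists R m.
exists (Z + Z')^-1, C; split; first by rewrite invr_gt0; lra.
split=> // a h a0 h0 small.
have sh0 : 0 < Num.sqrt h by rewrite sqrtr_gt0.
set x := a / Num.sqrt h.
have x0 : 0 < x by rewrite divr_gt0.
have xE : x ^+ 2 = a ^+ 2 / h by rewrite expr_div_n sqr_sqrtr// ltW.
have xV : a ^- 2 * h = (x ^+ 2)^-1 by rewrite xE invf_div mulrC.
have xZ : Z + Z' <= x ^+ 2.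
  move: small; rewrite xV ltf_pV2 ?posrE ?exprn_gt0//; first exact: ltW.
  by lra.
have [d dP] : exists d : nat -> R, forall j, (j <= m)%N -> shift_of j x (d j).
  have /choice[d dP] j : exists d, (j <= m)%N -> shift_of j x d.
    case: (leqP j m) => jm; last by exists 0.
    by have [|d dP] := H' x x0 _ j jm; [lra|exists d].
  by exists d.
have [|d0 [d0P d0U d0A]] := H x x0; first by lra.
have dE : d m = d0.
  have [/andP[dm0 dm1] dU] := dP m (leqnn m).
  have dI : 0 <= d m < 1 by rewrite ltW// (le_lt_trans dm1)// invf_lt1// ltr1n.
  by apply/(d0U _ dI)/(dU _ dI).
rewrite !half_oddE in d0A.
set w := d0 * _ in d0A.
exists (h * (2 * m%:R + 1 + 4 * d m)), (w - 1); split.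
  exact: nth_eigenvalue_interval.
split; first by rewrite xV.
rewrite dE [1 + (w - 1)]addrC subrK /w -xE.
rewrite powRD; last by rewrite (gt_eqF h0) implybT.
rewrite powRN !powR12_sqrt ?pi_ge0 ?(ltW h0)// powR_mulrn ?(ltW h0)//.
have aE : a ^+ (2 * m + 1) = x ^+ (2 * m + 1) * (h ^+ m * Num.sqrt h).
  rewrite -[in LHS](divfK (lt0r_neq0 sh0) a) exprMn; congr (_ * _).
  by rewrite exprD exprM expr1 sqr_sqrtr// ltW.
have hE : h = Num.sqrt h * Num.sqrt h by rewrite -expr2 sqr_sqrtr// ltW.
rewrite aE expRN [2 ^+ (2 + m)]exprD.
have X0 : x ^+ (2 * m + 1) != 0 by rewrite expf_neq0// gt_eqF.
have H0 : h ^+ m != 0 by rewrite expf_neq0// gt_eqF.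
have e0 : expR (x ^+ 2) != 0 by rewrite gt_eqF// expR_gt0.
have p0 : Num.sqrt pi != 0 :> R by rewrite gt_eqF// sqrtr_gt0 pi_gt0.
have f0 : m`!%:R != 0 :> R by rewrite pnatr_eq0 -lt0n fact_gt0.
have t0 : 2 ^+ m != 0 :> R by rewrite expf_neq0// pnatr_eq0.
move: (x ^+ (2 * m + 1)) (h ^+ m) (expR (x ^+ 2)) (Num.sqrt pi) (m`!%:R) (2 ^+ m)
  X0 H0 e0 p0 f0 t0 => X H1 e P f t X0 H0 e0 P0 f0 t0.
move: (Num.sqrt h) hE => S ->.
by field; rewrite X0 H0 e0 P0 f0 t0.
Qed.
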